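(* For every sufficiently large $n$ there is a connected graph $G=(V,E)$ with $\Theta(n)$ nodes such that for every source node $s\in V$ (i.e., $S_0=\{s\}$): (1) for the adversarial \textsc{RPull} protocol (with a suitable adaptive adversary), the expected number of rounds until all nodes of $V$ are informed is $\Omega(\sqrt{n})$; (2) with high probability, the random \textsc{RPull} protocol informs all nodes of $V$ within $O(\log^2 n)$ rounds.
   Context: Rumor spreading on a graph $G=(V,E)$ with $n$ nodes proceeds in synchronous rounds; $S_t$ denotes the set of informed nodes after $t$ rounds, starting from the set $S_0$ of initially informed nodes. Restricted pull (\textsc{RPull}): in each round, every uninformed node sends a request to a neighbor chosen uniformly at random (independently); every informed node $v$ that receives a nonempty set $R_v$ of requests in that round selects exactly one node of $R_v$, which then learns the rumor (other requests at $v$ are not served). In the adversarial \textsc{RPull} protocol, the selected node in $R_v$ is chosen by an adaptive adversary; in the random \textsc{RPull} protocol it is chosen uniformly at random from $R_v$, independently for different nodes and rounds. ''With high probability'' means with probability at least $1-n^{-c}$ for some constant $c\ge 1$. *)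

(* Defs.v *)
From HB Require Import structures.
From mathcomp Require Import all_boot all_order all_algebra.
From mathcomp Require Import all_classical all_reals all_analysis.
Set Implicit Arguments. Unset Strict Implicit. Unset Printing Implicit Defensive.
Import Order.TTheory GRing.Theory Num.Theory.
Local Open Scope ring_scope.

(* Rumor spreading with restricted pull (RPull) on a graph (V, e).
   A state is the set S of informed nodes.  In a round, every uninformed
   node u sends a request to a neighbour r u chosen uniformly at random
   (we encode the whole round's request choices as r : {ffun V -> V},
   with r u = u for informed nodes, which send no request). *)
Section RPull.
Variables (R : realType) (V : finType) (e : rel V).

Definition nbrs (u : V) : {set V} := [set w | e u w].

Definition req_weight (S : {set V}) (r : {ffun V -> V}) : R :=
  \prod_(u : V)
     (if u \in S then (r u == u)%:R
      else (e u (r u))%:R / #|nbrs u|%:R).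

Definition requests (S : {set V}) (r : {ffun V -> V}) (v : V) : {set V} :=
  [set u | (u \notin S) && (r u == v)].

Definition servers (S : {set V}) (r : {ffun V -> V}) : {set V} :=
  [set v in S | (0 < #|requests S r v|)%N].

Definition choice_weight (S : {set V}) (r : {ffun V -> V})
    (c : {ffun V -> V}) : R :=
  \prod_(v : V)
     (if v \in servers S r then
        (c v \in requests S r v)%:R / #|requests S r v|%:R
      else (c v == v)%:R).

Definition rand_trans (t : nat) (S S' : {set V}) : R :=
  \sum_(r : {ffun V -> V}) req_weight S r *
    \sum_(c : {ffun V -> V}) choice_weight S r c *
       (S' == S :|: [set c v | v in servers S r])%:R.

(* adaptive adversary: in round t, knowing the informed set S and the
   requests r of the round, selects for each server v the served node *)
Definition adversary := nat -> {set V} -> {ffun V -> V} -> V -> V.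

Definition valid_adversary (A : adversary) : Prop :=
  forall t S r v, v \in servers S r -> A t S r v \in requests S r v.

Definition adv_trans (A : adversary) (t : nat) (S S' : {set V}) : R :=
  \sum_(r : {ffun V -> V}) req_weight S r *
     (S' == S :|: [set A t S r v | v in servers S r])%:R.

Fixpoint state_dist (K : nat -> {set V} -> {set V} -> R) (S0 : {set V})
    (t : nat) (S' : {set V}) : R :=
  match t with
  | 0 => (S' == S0)%:R
  | t'.+1 => \sum_(S : {set V}) state_dist K S0 t' S * K t' S S'
  end.

(* Pr[S_t <> V] = Pr[T > t], T the first round with all nodes informed *)
Definition prob_not_done (K : nat -> {set V} -> {set V} -> R)
    (S0 : {set V}) (t : nat) : R :=
  \sum_(S : {set V} | S != [set: V]) state_dist K S0 t S.

(* E[T] = sum_{t >= 0} Pr[T > t]  (possibly +oo) *)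
Definition expected_time (K : nat -> {set V} -> {set V} -> R)
    (S0 : {set V}) : \bar R :=
  (\sum_(0 <= t <oo) (prob_not_done K S0 t)%:E)%E.

End RPull.

(* Main.v *)
(* The graph, with m ~ sqrt n and M = m^2, consists of two copies of a structure
   around a common vertex V.  Each copy has a clique W of M vertices and a binary
   heap Y of M vertices, all adjacent to V and to a hub H, which is adjacent to all
   of W.  Moreover there are small heaps X_i, i < m, whose roots are attached to V
   and to the i-th vertex of W.  A clique vertex asks the root of X_i with
   probability at most 1/M, so the rumor passes slowly from X_i to W but at once
   from W to X_i.

   Lower bound: in a copy not containing the source, the adversary lets V serve
   a root of some X_i whenever such a root asks V.  In expectation only O(1) heaps
   X_i get informed per round, so for about m rounds many roots keep asking V, the
   heap Y is not served, and W stays uninformed.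

   Upper bound: V serves a uniformly random request, so with constant probability
   it serves Y, and the rumor continues to all of Y, H, W and all X_i.  From there,
   and also from a source inside X_i, it returns to V through a vertex R_i adjacent
   to all of X_i and a heap Z all of whose vertices are adjacent to V; R_i asks Z
   with probability at most 1/m, so this way back hardly helps against the
   adversary.  Each hop succeeds with constant probability per round, and the
   heaps have O(log n) levels, which with O(log n) rounds per level gives
   O(log^2 n). *)
Require Import Defs.
From HB Require Import structures.
From mathcomp Require Import all_boot all_order all_algebra.
From mathcomp Require Import all_classical all_reals all_analysis.
From mathcomp Require Import ring lra zify fintype finset.
Set Implicit Arguments. Unset Strict Implicit. Unset Printing Implicit Defensive.
Import Order.TTheory GRing.Theory Num.Theory.
Local Open Scope ring_scope.

(** * One round of the protocol *)

Section ProductWeights.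
Variables (R : realType) (V : finType).

(** Independence: [w] describes a product measure on functions, so the expectation of a product over
    separate coordinates factors. Coordinates outside [B] contribute their total mass 1. *)
Lemma sum_ffun_prod (w : V -> V -> R) (B : {set V}) (G : V -> V -> R) :
  (forall u, \sum_x w u x = 1) ->
  \sum_(f : {ffun V -> V}) \prod_u w u (f u) * \prod_(u in B) G u (f u) =
  \prod_(u in B) \sum_x w u x * G u x.
Proof.
move=> w1; pose G' u x := if u \in B then G u x else 1.
transitivity (\sum_(f : {ffun V -> V}) \prod_u (w u (f u) * G' u (f u))).
  apply: eq_bigr => f _; rewrite big_split /=; congr (_ * _).
  by rewrite big_mkcond.
rewrite -(bigA_distr_bigA (fun u x => w u x * G' u x)) /= [RHS]big_mkcond /=.
apply: eq_bigr => u _; rewrite /G'; case: ifP => // _.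
by under eq_bigr do rewrite mulr1.
Qed.


Lemma sum_ffun_prod1 (w : V -> V -> R) :
  (forall u, \sum_x w u x = 1) ->
  \sum_(f : {ffun V -> V}) \prod_u w u (f u) = 1.
Proof.
move=> w1; have := sum_ffun_prod set0 (fun _ _ => 1) w1.
rewrite [X in _ = X]big_set0 => E; rewrite -[RHS]E; apply: eq_bigr => f _.
by rewrite big_set0 mulr1.
Qed.

Lemma sum_ffun_eval (w : V -> V -> R) u x :
  (forall u, \sum_x w u x = 1) ->
  \sum_(f : {ffun V -> V}) \prod_u w u (f u) * (f u == x)%:R = w u x.
Proof.
move=> w1; have := sum_ffun_prod [set u] (fun _ z => (z == x)%:R) w1.
rewrite big_set1 => E; rewrite -[RHS]mulr1.
transitivity (\sum_z w u z * (z == x)%:R).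
  by rewrite -E; apply: eq_bigr => f _; rewrite big_set1.
rewrite (bigD1 x) //= eqxx big1 ?addr0 // => z /negPf ->; exact: mulr0.
Qed.

Lemma sum_ffun_eval2 (w : V -> V -> R) u u' x x' :
  (forall u, \sum_x w u x = 1) -> u != u' ->
  \sum_(f : {ffun V -> V}) \prod_u w u (f u) * ((f u == x) && (f u' == x'))%:R
  = w u x * w u' x'.
Proof.
move=> w1 uu'.
have := sum_ffun_prod [set u; u']
  (fun y z => (z == (if y == u then x else x'))%:R) w1.
rewrite big_setU1 ?inE //= big_set1 eqxx eq_sym (negPf uu').
have S1 y t : \sum_z w y z * (z == t)%:R = w y t.
  rewrite (bigD1 t) //= eqxx mulr1 big1 ?addr0 // => z /negPf ->; exact: mulr0.
rewrite !S1 => <-; apply: eq_bigr => f _.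
rewrite big_setU1 ?inE //= big_set1 eqxx [u' == u]eq_sym (negPf uu').
by rewrite -natrM mulnb.
Qed.

End ProductWeights.

(** * Requests and choices as product measures, and the probability of being served *)

Section Round.
Variables (R : realType) (V : finType) (e : rel V).
Hypothesis deg_gt0 : forall u, (0 < #|nbrs e u|)%N.
Implicit Types (S : {set V}) (r c : {ffun V -> V}).

Definition rdeg (u : V) : R := #|nbrs e u|%:R.

Lemma deg_pos u : 0 < rdeg u. Proof. by rewrite ltr0n. Qed.

Lemma deg_ge1 u : 1 <= rdeg u. Proof. by rewrite ler1n. Qed.

Lemma sum_indicator (p : pred V) : \sum_x (p x)%:R = #|[set x | p x]|%:R :> R.
Proof. by rewrite -natr_sum -big_mkcond sum1dep_card. Qed.

Lemma sum_pred1 (u : V) : \sum_x (x == u)%:R = 1 :> R.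
Proof.
rewrite sum_indicator (_ : [set x | x == u] = [set u]) ?cards1 //.
by apply/setP=> x; rewrite !inE.
Qed.

(** The law of a single coordinate of the request function; [req_weight] is the product of these
    laws, and [choice_weight] likewise that of [pick]. *)
Definition ask S (u x : V) : R :=
  if u \in S then (x == u)%:R else (e u x)%:R / #|nbrs e u|%:R.

Lemma ask_sum1 S u : \sum_x ask S u x = 1.
Proof.
rewrite /ask; case: (u \in S); first exact: sum_pred1.
by rewrite -mulr_suml sum_indicator divff // gt_eqF ?deg_pos.
Qed.

Lemma ask_ge0 S u x : 0 <= ask S u x.
Proof. by rewrite /ask; case: ifP => _ //; rewrite divr_ge0. Qed.

Definition pick S r (x z : V) : R :=
  if x \in servers S r then (z \in requests S r x)%:R / #|requests S r x|%:R
  else (z == x)%:R.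

Lemma pick_sum1 S r x : \sum_z pick S r x z = 1.
Proof.
rewrite /pick; case xs: (x \in servers S r); last exact: sum_pred1.
move: (xs); rewrite inE => /andP[_ r0]; rewrite -mulr_suml sum_indicator.
rewrite (_ : [set z | z \in _] = requests S r x); last by apply/setP => z; rewrite !inE.
by rewrite divff // pnatr_eq0 -lt0n.
Qed.

Lemma pick_ge0 S r x z : 0 <= pick S r x z.
Proof. by rewrite /pick; case: ifP => _ //; rewrite divr_ge0. Qed.

Lemma req_weight_ge0 S r : 0 <= req_weight R e S r.
Proof. by apply: prodr_ge0 => u _; exact: ask_ge0. Qed.

Lemma choice_weight_ge0 S r c : 0 <= choice_weight R S r c.
Proof. by apply: prodr_ge0 => x _; exact: pick_ge0. Qed.

Lemma req_weight_sum1 S : \sum_r req_weight R e S r = 1.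
Proof. exact: (sum_ffun_prod1 (ask_sum1 S)). Qed.

Lemma choice_weight_sum1 S r : \sum_c choice_weight R S r c = 1.
Proof. exact: (sum_ffun_prod1 (pick_sum1 S r)). Qed.

Lemma req_weight_pr S u x : u \notin S ->
  \sum_r req_weight R e S r * (r u == x)%:R = (e u x)%:R / rdeg u.
Proof.
move=> uS; rewrite (sum_ffun_eval u x (ask_sum1 S)) /ask.
by rewrite (negPf uS).
Qed.

(** The sum is the expected number of requests at [x]; the extra 1 makes room for conditioning on
    the event that one fixed neighbour asks [x]. *)
Definition load S (x : V) : R := 1 + \sum_(y | (y \notin S) && e y x) (rdeg y)^-1.

Lemma load_ge1 S x : 1 <= load S x.
Proof. by rewrite lerDl sumr_ge0 // => y _; rewrite invr_ge0 ltW ?deg_pos. Qed.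

Definition serves S r c (x y : V) := (y \in requests S r x) && (c x == y).

Definition serve_pr S (x y : V) : R :=
  \sum_r req_weight R e S r *
    \sum_c choice_weight R S r c * (serves S r c x y)%:R.

Lemma card_requests S r x :
  #|requests S r x|%:R = \sum_(y | y \notin S) (r y == x)%:R :> R.
Proof.
rewrite -natr_sum -big_mkcondr -sum1_card; congr (_%:R).
by apply: eq_bigl => y; rewrite inE.
Qed.

(* Jensen's inequality for 1/|requests|, through the tangent of 1/t at t = load. *)
Lemma serve_pr_ge S x y : x \in S -> y \notin S -> e y x ->
  (rdeg y * load S x)^-1 <= serve_pr S x y.
Proof.
move=> xS yS eyx; set a := load S x.
have a0 : 0 < a by rewrite (lt_le_trans ltr01) ?load_ge1.
have Eserve : serve_pr S x y =
    \sum_r req_weight R e S r * ((r y == x)%:R / #|requests S r x|%:R).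
  apply: eq_bigr => r _; congr (_ * _); rewrite /serves.
  have [yr|yr] := boolP (y \in requests S r x); last first.
    rewrite big1 => [|c _]; last by rewrite mulr0.
    by move: yr; rewrite inE yS /= => /negPf ->; rewrite mul0r.
  rewrite (sum_ffun_eval x y (pick_sum1 S r)) /pick.
  have -> : x \in servers S r.
    by rewrite inE xS card_gt0; apply/set0Pn; exists y.
  by rewrite yr; move: yr; rewrite inE => /andP[_ ->].
have tangent r : (r y == x)%:R * (2 * a - #|requests S r x|%:R) / a ^+ 2 <=
    (r y == x)%:R / #|requests S r x|%:R.
  have [ryx|] := eqVneq; last by rewrite !mul0r.
  rewrite !mul1r; set k : R := #|requests S r x|%:R.
  have k0 : 0 < k.
    by rewrite ltr0n card_gt0; apply/set0Pn; exists y; rewrite inE yS ryx eqxx.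
  rewrite ler_pdivrMr ?exprn_gt0 // [k^-1 * _]mulrC ler_pdivlMr //.
  by have := sqr_ge0 (a - k); nra.
rewrite Eserve; apply: le_trans; last first.
  apply: ler_sum => r _; apply: ler_wpM2l; [exact: req_weight_ge0|exact: tangent].
have P1 := req_weight_pr x yS; rewrite eyx mul1r in P1.
(* Other nodes ask independently of [y], so the probabilities of two simultaneous requests factor;
   the term of [y] itself accounts for the 1 in [load]. *)
have P2 : \sum_r req_weight R e S r * ((r y == x)%:R * #|requests S r x|%:R) <=
    (rdeg y)^-1 * a.
  under eq_bigr do rewrite card_requests mulr_sumr mulr_sumr.
  rewrite exchange_big /= (bigD1 y) //= /a /load mulrDr mulr1; apply: lerD.
    under eq_bigr do rewrite -natrM mulnb andbb; by rewrite P1.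
  rewrite [X in _ <= _ * X]big_mkcondr mulr_sumr [X in _ <= X](bigD1 y) //= .
  apply: ler_wpDl.
    rewrite mulr_ge0 ?invr_ge0 ?(ltW (deg_pos _)) //.
    by case: ifP => // _; rewrite invr_ge0 ltW ?deg_pos.
  apply: ler_sum => z /andP[zS zy].
  under eq_bigr do rewrite -natrM mulnb.
  rewrite (sum_ffun_eval2 x x (ask_sum1 S)) 1?eq_sym // /ask (negPf yS) (negPf zS) eyx.
  by rewrite mul1r; case: (e z x); rewrite ?mul1r ?mul0r ?mulr0.
rewrite [X in _ <= X](_ : _ = (2 * a * (rdeg y)^-1 -
    \sum_r req_weight R e S r * ((r y == x)%:R * #|requests S r x|%:R)) / a ^+ 2); last first.
  rewrite -P1 mulr_sumr -sumrB mulr_suml; apply: eq_bigr => r _; ring.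
have d0 := deg_pos y.
rewrite ler_pdivlMr ?exprn_gt0 //.
have -> : (rdeg y * a)^-1 * a ^+ 2 = (rdeg y)^-1 * a.
  by field; rewrite !gt_eqF.
by lra.
Qed.

End Round.

(** * Markov chains on sets of informed vertices *)

Section Chain.
Variables (R : realType) (V : finType) (K : nat -> {set V} -> {set V} -> R).
Hypothesis K_ge0 : forall t S S', 0 <= K t S S'.
Hypothesis K_sum1 : forall t S, \sum_S' K t S S' = 1.

Lemma state_dist_ge0 S0 t S : 0 <= state_dist K S0 t S.
Proof.
elim: t S => [|t IH] S /=; first by [].
by apply: sumr_ge0 => S' _; rewrite mulr_ge0.
Qed.

Lemma state_dist_step S0 t (f : {set V} -> R) :
  \sum_S state_dist K S0 t.+1 S * f S =
  \sum_S state_dist K S0 t S * \sum_S' K t S S' * f S'.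
Proof.
under eq_bigr do rewrite /= mulr_suml.
rewrite exchange_big /=; apply: eq_bigr => S _.
by rewrite mulr_sumr; apply: eq_bigr => S' _; rewrite mulrA.
Qed.

Lemma state_dist0 S0 (f : {set V} -> R) :
  \sum_S state_dist K S0 0 S * f S = f S0.
Proof.
rewrite (bigD1 S0) //= eqxx mul1r big1 ?addr0 // => S /negPf ->.
by rewrite mul0r.
Qed.

Lemma state_dist_sum1 S0 t : \sum_S state_dist K S0 t S = 1.
Proof.
elim: t => [|t IH].
  by rewrite -(state_dist0 S0 (fun _ => 1)); apply: eq_bigr => S _; rewrite mulr1.
transitivity (\sum_S state_dist K S0 t.+1 S * 1).
  by apply: eq_bigr => S _; rewrite mulr1.
rewrite state_dist_step -[RHS]IH; apply: eq_bigr => S _.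
by under eq_bigr do rewrite mulr1; rewrite K_sum1 mulr1.
Qed.

(** Additive drift: each round adds at most [d] because the state distribution has mass 1. It serves
    the lower bound. *)
Lemma expect_le_drift S0 t (h : {set V} -> R) (d : R) :
  (forall t S, \sum_S' K t S S' * h S' <= h S + d) ->
  \sum_S state_dist K S0 t S * h S <= h S0 + t%:R * d.
Proof.
move=> drift; elim: t => [|t IH]; first by rewrite state_dist0 mul0r addr0.
rewrite state_dist_step -natr1 mulrDl mul1r addrA.
apply: (le_trans _ (lerD IH (lexx d))).
rewrite -[X in _ <= _ + X]mul1r -(state_dist_sum1 S0 t) mulr_suml -big_split /=.
apply: ler_sum => S _; rewrite -mulrDr.
by apply: ler_wpM2l; [exact: state_dist_ge0|exact: drift].
Qed.

Hypothesis K_mono : forall t S S', K t S S' != 0 -> S \subset S'.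

Definition upclosed (A : pred {set V}) :=
  forall S S' : {set V}, S \subset S' -> A S -> A S'.

Lemma state_dist_mono S0 t S : state_dist K S0 t S != 0 -> S0 \subset S.
Proof.
elim: t S => [|t IH] S /=.
  by have [->//|_] := eqVneq S S0; rewrite eqxx.
move=> /eqP nz; apply/negPn/negP => nS; apply: nz; apply: big1 => S' _.
have [->|/IH S0S'] := eqVneq (state_dist K S0 t S') 0; first by rewrite mul0r.
have [->|/K_mono S'S] := eqVneq (K t S' S) 0; first by rewrite mulr0.
by case/negP: nS; exact: subset_trans S0S' S'S.
Qed.

(** Multiplicative drift. The contraction is required only on [A], since an upward closed event is
    never left by a growing chain. *)
Lemma expect_le_geom (A : pred {set V}) S0 t (h : {set V} -> R) (l : R) :
  upclosed A -> 0 <= l ->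
  (forall t S, A S -> \sum_S' K t S S' * h S' <= l * h S) -> A S0 ->
  \sum_S state_dist K S0 t S * h S <= l ^+ t * h S0.
Proof.
move=> Aup l0 drift AS0; elim: t => [|t IH].
  by rewrite state_dist0 expr0 mul1r.
rewrite state_dist_step exprS -mulrA; apply: le_trans (ler_wpM2l l0 IH).
rewrite mulr_sumr; apply: ler_sum => S _.
have [->|nz] := eqVneq (state_dist K S0 t S) 0; first by rewrite !mul0r mulr0.
rewrite mulrCA; apply: ler_wpM2l; first exact: state_dist_ge0.
by apply: drift; apply: Aup AS0; exact: state_dist_mono nz.
Qed.

End Chain.

(** * Reaching a class of states within a given time, up to a failure probability *)

Section Homogeneous.
Variables (R : realType) (V : finType) (Q : {set V} -> {set V} -> R).
Hypothesis Q_ge0 : forall S S', 0 <= Q S S'.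
Hypothesis Q_sum1 : forall S, \sum_S' Q S S' = 1.
Hypothesis Q_mono : forall S S', Q S S' != 0 -> S \subset S'.

Notation dist := (state_dist (fun _ => Q)).

Lemma state_distD S0 t1 t2 S' :
  dist S0 (t1 + t2) S' = \sum_S dist S0 t1 S * dist S t2 S'.
Proof.
elim: t2 S' => [|t2 IH] S' /=.
  rewrite addn0 (bigD1 S') //= eqxx mulr1 big1 ?addr0 // => S.
  by rewrite eq_sym => /negPf ->; rewrite mulr0.
rewrite addnS /=; under eq_bigr do rewrite IH mulr_suml.
rewrite exchange_big /=; apply: eq_bigr => S _.
by rewrite mulr_sumr; apply: eq_bigr => S'' _; rewrite mulrA.
Qed.

(** A probabilistic Hoare triple with running time [t] and failure probability [x]. [B] is tested at
    time [t] itself; for upward closed [B] this is the same as having been reached by then. *)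
Variant leads t (x : R) (A B : pred {set V}) : Prop :=
  Leads of forall S, A S -> \sum_S' dist S t S' * (~~ B S')%:R <= x.

Lemma leads_refl (A B : pred {set V}) : (forall S, A S -> B S) -> leads 0 0 A B.
Proof. by move=> AB; split=> S AS; rewrite state_dist0 AB. Qed.

Lemma leads_le t x y (A B : pred {set V}) : x <= y -> leads t x A B -> leads t y A B.
Proof. by move=> xy [AB]; split=> S /AB /le_trans; apply. Qed.

Lemma leads_pre t x (A A' B : pred {set V}) :
  (forall S, A' S -> A S) -> leads t x A B -> leads t x A' B.
Proof. by move=> AA' [AB]; split=> S /AA' /AB. Qed.

Lemma leads_post t x (A B B' : pred {set V}) :
  (forall S, B S -> B' S) -> leads t x A B -> leads t x A B'.
Proof.
move=> BB' [AB]; split=> S /AB; apply: le_trans; apply: ler_sum => S' _.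
apply: ler_wpM2l; first exact: state_dist_ge0.
by rewrite ler_nat; case: (boolP (B S')) => [/BB' ->|_] //; case: (B' S').
Qed.

(** Markov property at time [t1] with a union bound: states outside [B] are charged in full, those
    in [B] cost at most [y]. *)
Lemma leads_trans t1 t2 x y (A B C : pred {set V}) :
  0 <= y -> leads t1 x A B -> leads t2 y B C -> leads (t1 + t2) (x + y) A C.
Proof.
move=> y0 [AB] [BC]; split=> S AS.
under eq_bigr do rewrite state_distD mulr_suml.
rewrite exchange_big /=.
have -> : x + y = x + \sum_S' dist S t1 S' * y.
  by rewrite -mulr_suml state_dist_sum1 ?mul1r.
apply: le_trans (lerD (AB S AS) (lexx _)).
rewrite -big_split /=; apply: ler_sum => S' _; rewrite -mulrDr.
under eq_bigr do rewrite -mulrA; rewrite -mulr_sumr.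
apply: ler_wpM2l; first exact: state_dist_ge0.
case: (boolP (B S')) => [BS'|_]; first by rewrite add0r; exact: BC.
apply: (@le_trans _ _ 1); last by rewrite lerDl.
rewrite -[X in _ <= X](state_dist_sum1 (K := fun _ => Q) (fun _ => Q_sum1) S' t2).
by apply: ler_sum => S'' _; rewrite ler_piMr ?state_dist_ge0 //; case: (C S'').
Qed.

(** Informed nodes stay informed, so waiting longer adds no failure probability. *)
Lemma leads_mono t t' x (A B : pred {set V}) : upclosed B ->
  (t <= t')%N -> leads t x A B -> leads t' x A B.
Proof.
move=> Bup tt' AB; rewrite -(subnKC tt') -[x]addr0.
apply: leads_trans AB _ => //; split=> S BS.
rewrite big1 // => S' _; have [->|nz] := eqVneq (dist S (t' - t) S') 0.
  by rewrite mul0r.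
by rewrite (Bup S S') ?mulr0 //; apply: (state_dist_mono (K := fun _ => Q)) nz.
Qed.

Lemma leads_forall (I : finType) (P : pred I) t x (A : pred {set V})
    (B : I -> pred {set V}) :
  (forall i, P i -> leads t x A (B i)) ->
  leads t (#|[set i | P i]|%:R * x) A (fun S => [forall i, P i ==> B i S]).
Proof.
move=> AB; split=> S AS.
apply: (@le_trans _ _ (\sum_(i | P i) \sum_S' dist S t S' * (~~ B i S')%:R)).
  rewrite exchange_big /=; apply: ler_sum => S' _; rewrite -mulr_sumr.
  apply: ler_wpM2l; first exact: state_dist_ge0.
  case: (boolP [forall i, _]) => [_|]; first exact: sumr_ge0.
  rewrite negb_forall => /existsP[i]; rewrite negb_imply => /andP[Pi nB].
  by rewrite (bigD1 i) //= nB lerDl sumr_ge0.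
apply: (@le_trans _ _ (\sum_(i | P i) x)).
  by apply: ler_sum => i Pi; have [+] := AB i Pi; apply.
rewrite sumr_const mulr_natl (_ : #|P| = #|[set i | P i]|) //.
by apply: eq_card => i; rewrite inE.
Qed.

(** Markov's inequality for a potential [h] that dominates the indicator of failure and contracts by
    the factor [l] in each round. *)
Lemma leads_geom t (A B : pred {set V}) (h : {set V} -> R) (l x : R) :
  upclosed A -> 0 <= l ->
  (forall S, A S -> \sum_S' Q S S' * h S' <= l * h S) ->
  (forall S, A S -> (~~ B S)%:R <= h S) -> (forall S, A S -> h S <= x) ->
  leads t (x * l ^+ t) A (fun S => A S && B S).
Proof.
move=> Aup l0 drift hB hx; split=> S AS.
apply: (@le_trans _ _ (\sum_S' dist S t S' * h S')).
  apply: ler_sum => S' _.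
  have [->|nz] := eqVneq (dist S t S') 0; first by rewrite !mul0r.
  apply: ler_wpM2l; first exact: state_dist_ge0.
  have AS' : A S' by apply: Aup AS; apply: (state_dist_mono (K := fun _ => Q)) nz.
  by rewrite AS' hB.
apply: (le_trans (expect_le_geom (K := fun _ => Q) _ _ _ Aup l0 _ AS)) => //.
by rewrite mulrC ler_wpM2r ?exprn_ge0 // hx.
Qed.

End Homogeneous.

(** * The random protocol *)

Section RandomProtocol.
Variables (R : realType) (V : finType) (e : rel V).
Hypothesis deg_gt0 : forall u, (0 < #|nbrs e u|)%N.
Implicit Types (S : {set V}) (r c : {ffun V -> V}).

Local Notation deg := (rdeg R e).
Local Notation load := (load R e).
Local Notation serve_pr := (serve_pr R e).

Definition next S r c := S :|: [set c v | v in servers S r].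

Lemma subset_next S r c : S \subset next S r c.
Proof. exact: subsetUl. Qed.

Lemma serves_next S r c x y : x \in S -> serves S r c x y -> y \in next S r c.
Proof.
move=> xS /andP[yr /eqP cxy]; apply/setUP; right; apply/imsetP.
by exists x => //; rewrite inE xS card_gt0; apply/set0Pn; exists y.
Qed.

Lemma serves_inj S r c x x' y : serves S r c x y -> serves S r c x' y -> x = x'.
Proof.
by rewrite /serves !inE => /andP[/andP[_ /eqP <-] _] /andP[/andP[_ /eqP <-] _].
Qed.

Lemma serves_fun S r c x y y' : serves S r c x y -> serves S r c x y' -> y = y'.
Proof. by rewrite /serves => /andP[_ /eqP <-] /andP[_ /eqP <-]. Qed.

Lemma rand_trans_expect t S (f : {set V} -> R) :
  \sum_S' rand_trans R e t S S' * f S' =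
  \sum_r req_weight R e S r * \sum_c choice_weight R S r c * f (next S r c).
Proof.
rewrite /rand_trans; under eq_bigr do rewrite mulr_suml.
rewrite exchange_big /=; apply: eq_bigr => r _.
under eq_bigr do rewrite -mulrA.
rewrite -mulr_sumr; congr (_ * _).
under [LHS]eq_bigr do rewrite mulr_suml.
rewrite exchange_big /=; apply: eq_bigr => c _.
rewrite (bigD1 (next S r c)) //= eqxx mulr1 big1 ?addr0 // => S' /negPf nS'.
by rewrite -/(next S r c) nS' mulr0 mul0r.
Qed.

Lemma rand_trans_ge0 t S S' : 0 <= rand_trans R e t S S'.
Proof.
apply: sumr_ge0 => r _; apply: mulr_ge0; first exact: req_weight_ge0.
by apply: sumr_ge0 => c _; rewrite mulr_ge0 // choice_weight_ge0.
Qed.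

Lemma rand_trans_sum1 t S : \sum_S' rand_trans R e t S S' = 1.
Proof.
transitivity (\sum_S' rand_trans R e t S S' * 1).
  by apply: eq_bigr => S' _; rewrite mulr1.
rewrite rand_trans_expect -[RHS](req_weight_sum1 R deg_gt0 S).
apply: eq_bigr => r _; under eq_bigr do rewrite mulr1.
by rewrite choice_weight_sum1 mulr1.
Qed.

Lemma rand_trans_mono t S S' : rand_trans R e t S S' != 0 -> S \subset S'.
Proof.
apply: contraNT => nSS'; rewrite /rand_trans big1 // => r _.
rewrite big1 ?mulr0 // => c _; case: eqP => [E|_]; last by rewrite mulr0.
by rewrite E subset_next in nSS'.
Qed.

(** Linearity of expectation: a bound per outcome in terms of the number of service events becomes a
    bound in terms of [serve_pr]. *)
Lemma rand_trans_expect_le t S (f : {set V} -> R) (a b : R)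
    (I : finType) (P : pred I) (g h : I -> V) :
  (forall r c, f (next S r c) <= a - b * \sum_(i | P i) (serves S r c (g i) (h i))%:R) ->
  \sum_S' rand_trans R e t S S' * f S' <= a - b * \sum_(i | P i) serve_pr S (g i) (h i).
Proof.
move=> fle; rewrite rand_trans_expect.
have -> : a - b * \sum_(i | P i) serve_pr S (g i) (h i) =
   \sum_r req_weight R e S r * \sum_c choice_weight R S r c *
     (a - b * \sum_(i | P i) (serves S r c (g i) (h i))%:R).
  have Ea : a = \sum_r req_weight R e S r * (\sum_c choice_weight R S r c * a).
    under eq_bigr do rewrite -mulr_suml choice_weight_sum1 mul1r.
    by rewrite -mulr_suml req_weight_sum1 // mul1r.
  rewrite [X in X - _]Ea exchange_big mulr_sumr -sumrB; apply: eq_bigr => r _.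
  rewrite -mulr_sumr [b * (req_weight _ _ _ _ * _)]mulrCA -mulrBr; congr (_ * _).
  rewrite exchange_big mulr_sumr -sumrB; apply: eq_bigr => c _.
  by rewrite -mulr_sumr mulrBr [b * (choice_weight _ _ _ _ * _)]mulrCA.
apply: ler_sum => r _; apply: ler_wpM2l; first exact: req_weight_ge0.
by apply: ler_sum => c _; apply: ler_wpM2l; rewrite ?choice_weight_ge0.
Qed.

(** For mutually exclusive events the count is the indicator of the union, so lower bounds on their
    probabilities may be added. *)
Lemma sum_indicator_le1 (I : finType) (P Q : pred I) :
  (forall i j, P i -> P j -> Q i -> Q j -> i = j) ->
  \sum_(i | P i) (Q i)%:R <= [exists i, P i && Q i]%:R :> R.
Proof.
move=> PQ; have [/existsP[i /andP[Pi Qi]]|] := boolP [exists i, P i && Q i].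
  rewrite (bigD1 i) //= Qi big1 ?addr0 // => j /andP[Pj /negP ji].
  by case Qj: (Q j) => //; case: ji; rewrite (PQ j i).
rewrite negb_exists => /forallP nPQ; rewrite big1 // => i Pi.
by have := nPQ i; rewrite Pi /= => /negPf ->.
Qed.

Local Notation leads := (leads (rand_trans R e 0)).

(** A node asks one neighbour per round, so the events of being served by different [x] exclude each
    other and their probabilities add up to at least [p]. *)
Lemma leads_hop t (A : pred {set V}) y (p : R) :
  upclosed A -> 0 <= p <= 1 ->
  (forall S, A S -> y \notin S ->
     p <= \sum_(x in S | e y x) (deg y * load S x)^-1) ->
  leads t ((1 - p) ^+ t) A (fun S => A S && (y \in S)).
Proof.
move=> Aup /andP[p0 p1] hp; rewrite -[X in leads t X]mul1r.
apply: (leads_geom (rand_trans_ge0 0) (@rand_trans_mono 0) t (h := fun S => (y \notin S)%:R)) => //.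
- by rewrite subr_ge0.
- move=> S AS; have [yS|yS] := boolP (y \in S).
    rewrite mulr0 big1 // => S' _.
    have [->|nz] := eqVneq (rand_trans R e 0 S S') 0; first by rewrite mul0r.
    by rewrite (subsetP (rand_trans_mono nz)) // mulr0.
  rewrite mulr1.
  apply: (@le_trans _ _ (1 - 1 * \sum_(x in S | e y x) serve_pr S x y)).
    apply: rand_trans_expect_le => r c; rewrite mul1r.
    rewrite lerBrDr -lerBrDl; apply: le_trans (sum_indicator_le1 _) _.
      by move=> x x' _ _; exact: serves_inj.
    case: existsP => [[x /andP[/andP[xS _] /(serves_next xS) ->]]|_].
      by rewrite subr0.
    by rewrite subr_ge0; case: (_ \notin _).
  rewrite mul1r lerD2l lerN2 (le_trans (hp S AS yS)) //.
  by apply: ler_sum => x /andP[xS eyx]; exact: serve_pr_ge.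
- by move=> S _; case: (y \notin S).
Qed.

Definition hits (B : {set V}) : pred {set V} := fun S => [exists y in B, y \in S].

Lemma upclosed_hits B : upclosed (hits B).
Proof.
move=> S S' SS' /existsP[y /andP[yB yS]]; apply/existsP; exists y.
by rewrite yB (subsetP SS').
Qed.

(** Dual to [leads_hop]: one server answers a single request, so the events of serving different [y]
    in [B] are exclusive. The server [x] may depend on the state. *)
Lemma leads_hits t (A : pred {set V}) (B : {set V}) (p : R) :
  upclosed A -> 0 <= p <= 1 ->
  (forall S, A S -> ~~ hits B S -> exists2 x, x \in S &
     p <= \sum_(y in B | e y x) (deg y * load S x)^-1) ->
  leads t ((1 - p) ^+ t) A (fun S => A S && hits B S).
Proof.
move=> Aup /andP[p0 p1] hp; rewrite -[X in leads t X]mul1r.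
apply: (leads_geom (rand_trans_ge0 0) (@rand_trans_mono 0) t
  (h := fun S => (~~ hits B S)%:R)) => //.
- by rewrite subr_ge0.
- move=> S AS; have [BS|BS] := boolP (hits B S).
    rewrite mulr0 big1 // => S' _.
    have [->|nz] := eqVneq (rand_trans R e 0 S S') 0; first by rewrite mul0r.
    by rewrite (upclosed_hits (rand_trans_mono nz)) // mulr0.
  rewrite mulr1; have [x xS px] := hp S AS BS.
  apply: (@le_trans _ _ (1 - 1 * \sum_(y in B | e y x) serve_pr S x y)).
    apply: rand_trans_expect_le => r c; rewrite mul1r.
    rewrite lerBrDr -lerBrDl; apply: le_trans (sum_indicator_le1 _) _.
      by move=> y y' _ _; exact: serves_fun.
    case: existsP => [[y /andP[/andP[yB _] /(serves_next xS) yn]]|_].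
      suff -> : hits B (next S r c) by rewrite subr0.
      by apply/existsP; exists y; rewrite yB.
    by rewrite subr_ge0; case: (~~ _).
  rewrite mul1r lerD2l lerN2 (le_trans px) //.
  apply: ler_sum => y /andP[yB eyx]; apply: serve_pr_ge => //.
  by apply/negP => yS; case/negP: BS; apply/existsP; exists y; rewrite yB.
- by move=> S _; case: (~~ _).
Qed.

Definition half_of (W : {set V}) : pred {set V} :=
  fun S => (#|W| <= 2 * #|S :&: W|)%N.

Lemma upclosed_half W : upclosed (half_of W).
Proof.
move=> S S' SS'; rewrite /half_of => /leq_trans; apply.
by rewrite leq_mul2l subset_leq_card ?orbT ?setSI.
Qed.

(* The reciprocal of the number of informed nodes of the clique is a
   supermartingale with geometric decay until half of the clique is informed:
   if [n <= k] nodes are added to [k], then [1 / (k + n) <= (1 - n / (2 k)) / k]. *)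
Lemma leads_half t (W : {set V}) (a d : R) :
  {in W &, forall x y, x != y -> e x y} -> 0 < a -> 0 < d ->
  (forall S x, x \in S :&: W -> load S x <= a) ->
  (forall y, y \in W -> deg y <= d) -> #|W|%:R <= 4 * a * d ->
  leads t (#|W|%:R * (1 - #|W|%:R / (4 * a * d)) ^+ t) (hits W) (half_of W).
Proof.
move=> clique a0 d0 loadW degW Wad.
have ad0 : 0 < 4 * a * d by nra.
set n := #|W|%:R in Wad *.
pose h S : R := if half_of W S then 0 else n / #|S :&: W|%:R.
have hits_gt0 S : hits W S -> 1 <= #|S :&: W|%:R :> R.
  case/existsP => y /andP[yW yS]; rewrite ler1n card_gt0; apply/set0Pn.
  by exists y; rewrite inE yS.
have nhalf S : ~~ half_of W S -> 2 * #|S :&: W|%:R <= n.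
  by rewrite /half_of -ltnNge => /ltnW; rewrite -natrM ler_nat.
suff H : leads t (n * (1 - n / (4 * a * d)) ^+ t) (hits W)
    (fun S => hits W S && half_of W S).
  by apply: (leads_post (rand_trans_ge0 0) _ H) => S /andP[].
apply: (leads_geom (rand_trans_ge0 0) (@rand_trans_mono 0) t (h := h)).
- exact: upclosed_hits.
- by rewrite subr_ge0 ler_pdivrMr // mul1r.
- move=> S mS; rewrite /h; have [hS|hS] := boolP (half_of W S).
    rewrite mulr0 big1 // => S' _.
    have [->|nz] := eqVneq (rand_trans R e 0 S S') 0; first by rewrite mul0r.
    by rewrite (upclosed_half (rand_trans_mono nz)) // mulr0.
  set k : R := #|S :&: W|%:R.
  have k1 : 1 <= k by exact: hits_gt0.
  have kn : 2 * k <= n by exact: nhalf.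
  have k0 : 0 < k by lra.
  pose P := [pred p : V * V | (p.1 \in S :&: W) && (p.2 \in W :\: S)].
  have n0 : 0 < n by lra.
  apply: (@le_trans _ _ (n / k - n / (2 * k ^+ 2) * \sum_(p | P p) serve_pr S p.1 p.2)).
    apply: rand_trans_expect_le => r c; set N := \sum_(p | _) _.
    have N0 : 0 <= N by exact: sumr_ge0.
    have EN1 : N = \sum_(x in S :&: W) \sum_(y in W :\: S) (serves S r c x y)%:R.
      by rewrite pair_big.
    (* Each informed clique vertex serves at most one node, and each new vertex has only one server,
       so [N] counts distinct new clique vertices. *)
    have Nk : N <= k.
      rewrite EN1 /k -sum1_card natr_sum; apply: ler_sum => x _.
      apply: le_trans (sum_indicator_le1 _) _; last by case: [exists _, _].
      by move=> y y' _ _; exact: serves_fun.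
    have Nnext : k + N <= #|next S r c :&: W|%:R.
      rewrite -(cardsID S (next S r c :&: W)) natrD; apply: lerD.
        rewrite ler_nat subset_leq_card //; apply/subsetP => x.
        by rewrite !inE => /andP[-> ->].
      rewrite EN1 exchange_big /= -sum1_card natr_sum big_mkcond [X in _ <= X]big_mkcond.
      apply: ler_sum => y _; rewrite !inE; case yW: (y \in W); last by rewrite !andbF.
      case yS: (y \in S) => //=; rewrite andbT.
      apply: le_trans (sum_indicator_le1 _) _; first by move=> x x' _ _; exact: serves_inj.
      case: existsP => [[x /andP[+ /serves_next xy]]|_]; last by case: ifP.
      by rewrite inE => /andP[/xy + _]; rewrite !inE yS /= => ->.
    case: ifP => _.
      have -> : n / k - n / (2 * k ^+ 2) * N = n / k ^+ 2 * (k - N / 2).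
        by field; rewrite gt_eqF.
      by apply: mulr_ge0; [rewrite divr_ge0 ?exprn_ge0 ?ltW|lra].
    apply: (@le_trans _ _ (n / (k + N))).
      by rewrite ler_wpM2l ?(ltW n0) // lef_pV2 ?posrE //; lra.
    rewrite -subr_ge0.
    have -> : n / k - n / (2 * k ^+ 2) * N - n / (k + N) =
       n * N * (k - N) / (2 * k ^+ 2 * (k + N)).
      by field; rewrite -/k !gt_eqF //; lra.
    apply: divr_ge0; first by rewrite !mulr_ge0 ?(ltW n0) //; lra.
    by rewrite !mulr_ge0 //; nra.
  (* There are [k] servers and at least [n / 2] uninformed clique vertices; each such pair succeeds
     with probability at least [(d * a)^-1]. *)
  have low : k * (n / 2) * (d * a)^-1 <= \sum_(p | P p) serve_pr S p.1 p.2.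
    have -> : \sum_(p | P p) serve_pr S p.1 p.2 =
      \sum_(x in S :&: W) \sum_(y in W :\: S) serve_pr S x y by rewrite [RHS]pair_big.
    have Wk : n / 2 <= #|W :\: S|%:R.
      have := cardsID S W; rewrite setIC => /(congr1 (fun i => i%:R : R)).
      by rewrite natrD -/n -/k; lra.
    have -> : k = \sum_(x in S :&: W) 1 by rewrite /k -sum1_card natr_sum.
    rewrite -mulrA mulr_suml; apply: ler_sum => x; rewrite inE => /andP[xS xW].
    rewrite mul1r; apply: (@le_trans _ _ (\sum_(y in W :\: S) (d * a)^-1)).
      rewrite sumr_const -[X in _ <= X]mulr_natl ler_wpM2r //.
      by rewrite invr_ge0 mulr_ge0 ?ltW.
    apply: ler_sum => y; rewrite inE => /andP[yS yW].
    apply: (le_trans _ (serve_pr_ge R deg_gt0 xS yS _)); last first.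
      by apply: clique => //; apply: contraNneq yS => ->.
    have l0 : 0 < load S x by rewrite (lt_le_trans ltr01) ?load_ge1.
    have dy0 := deg_pos R deg_gt0 y.
    rewrite lef_pV2 ?posrE ?mulr_gt0 //.
    apply: ler_pM (ltW dy0) (ltW l0) (degW _ yW) _.
    by apply: loadW; rewrite inE xS.
  apply: (@le_trans _ _ (n / k - n / (2 * k ^+ 2) * (k * (n / 2) * (d * a)^-1))).
    rewrite lerD2l lerN2 ler_wpM2l // divr_ge0 ?(ltW n0) //.
    by rewrite mulr_ge0 // exprn_ge0 ?ltW.
  by rewrite le_eqVlt; apply/orP; left; apply/eqP; field; rewrite !gt_eqF.
- move=> S mS; rewrite /h; have [|hS] := boolP (half_of W S) => //=.
  have := nhalf _ hS; have k1 := hits_gt0 S mS => kn.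
  by rewrite ler_pdivlMr ?mul1r; lra.
- move=> S mS; rewrite /h; case: ifP => _ //.
  have k1 := hits_gt0 S mS; rewrite ler_pdivrMr; last lra.
  by have : 0 <= n by []; nra.
Qed.

End RandomProtocol.

(** * The graph *)

Section Node.
Variable m : nat.

(** The Boolean names the copy; [NZ] and [NV] carry none, as Z and V are shared by both copies.
    [NX b i k] is vertex [k] of the heap X_i. *)
Variant node :=
  | NX of bool & 'I_m & 'I_m
  | NR of bool & 'I_m
  | NY of bool & 'I_(m * m)
  | NH of bool
  | NW of bool & 'I_(m * m)
  | NZ of 'I_(m * m)
  | NV.

Local Notation node_sum := ((bool * 'I_m * 'I_m) + (bool * 'I_m) +
  (bool * 'I_(m * m)) + bool + (bool * 'I_(m * m)) + 'I_(m * m) + unit)%type.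

Definition node_to_sum (z : node) : node_sum :=
  match z with
  | NX b i k => inl (inl (inl (inl (inl (inl (b, i, k))))))
  | NR b i => inl (inl (inl (inl (inl (inr (b, i))))))
  | NY b k => inl (inl (inl (inl (inr (b, k)))))
  | NH b => inl (inl (inl (inr b)))
  | NW b j => inl (inl (inr (b, j)))
  | NZ k => inl (inr k)
  | NV => inr tt
  end.

Definition node_of_sum (s : node_sum) : node :=
  match s with
  | inl (inl (inl (inl (inl (inl (b, i, k)))))) => NX b i k
  | inl (inl (inl (inl (inl (inr (b, i)))))) => NR b i
  | inl (inl (inl (inl (inr (b, k))))) => NY b k
  | inl (inl (inl (inr b))) => NH b
  | inl (inl (inr (b, j))) => NW b j
  | inl (inr k) => NZ k
  | inr tt => NV
  end.

Lemma node_to_sumK : cancel node_to_sum node_of_sum.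
Proof. by case. Qed.

Lemma node_of_sumK : cancel node_of_sum node_to_sum.
Proof. by case=> [[[[[[[[b i] k]|[b i]]|[b k]]|b]|[b j]]|k]|[]]. Qed.

HB.instance Definition _ := Finite.copy node (can_type node_to_sumK).

Lemma card_node : #|{: node}| = (7 * (m * m) + 2 * m + 3)%N.
Proof.
rewrite (bij_eq_card (Bijective node_to_sumK node_of_sumK)).
rewrite !card_sum !card_prod card_bool !card_ord card_unit; lia.
Qed.

(* Binary heap numbering: the children of [k] are [2k+1] and [2k+2]. *)
Definition par (k k' : nat) := (0 < k)%N && (k' == k.-1./2).

(** Edges are listed in one direction, heap edges from child to parent, and [adj] symmetrizes. Only
    the first [m] vertices of W and of Z have a partner among the X_i and R_i. *)
Definition link (x y : node) : bool :=
  match x, y with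
  | NX b i k, NX b' i' k' => [&& b == b', i == i' & par k k']
  | NX b i k, NR b' i' => (b == b') && (i == i')
  | NX b i k, NV => k == 0%N :> nat
  | NX b i k, NW b' j => [&& k == 0%N :> nat, b == b' & i == j :> nat]
  | NR b i, NZ k => i == k :> nat
  | NY b k, NY b' k' => (b == b') && par k k'
  | NY b k, NV => true
  | NY b k, NH b' => b == b'
  | NW b j, NH b' => b == b'
  | NW b j, NW b' j' => (b == b') && (j != j')
  | NZ k, NZ k' => par k k'
  | NZ k, NV => true
  | _, _ => false
  end.

Definition adj (x y : node) := link x y || link y x.

Lemma adjC : symmetric adj.
Proof. by move=> x y; rewrite /adj orbC. Qed.

Lemma par_irr k : par k k = false.
Proof. rewrite /par; lia. Qed.

Lemma adj_irr : irreflexive adj.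
Proof.
by case=> [b i k|b i|b k|b|b j|k|] //; rewrite /adj /= ?eqxx ?par_irr.
Qed.

Lemma card_le_code (T : finType) (A : {set T}) (f : T -> nat) n :
  {in A &, injective f} -> (forall x, x \in A -> (f x < n)%N) -> (#|A| <= n)%N.
Proof.
move=> finj fn; rewrite cardE -(size_map f) -[X in (_ <= X)%N](size_iota 0).
apply: uniq_leq_size.
  rewrite map_inj_in_uniq ?enum_uniq // => x y.
  by rewrite !mem_enum; exact: finj.
by move=> _ /mapP[x + ->]; rewrite mem_enum mem_iota => /fn.
Qed.

Definition low (x : node) :=
  match x with NX _ _ _ | NY _ _ | NZ _ => true | _ => false end.

Lemma adjX b i k z : adj (NX b i k) z ->
  match z with
  | NX b' i' k' => [/\ b' = b, i' = i & par k k' \/ par k' k]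
  | NR b' i' => b' = b /\ i' = i
  | NW b' j => [/\ b' = b, j = i :> nat & k = 0%N :> nat]
  | NV => k = 0%N :> nat
  | _ => False
  end.
Proof.
rewrite /adj; case: z => [b' i' k'|b' i'|b' k'|b'|b' j'|k'|] //=; rewrite ?orbF.
- case/orP => /and3P[/eqP -> /eqP -> ?]; split => //; [by left|by right].
- by case/andP => /eqP -> /eqP ->.
- by case/and3P => /eqP ? /eqP -> /eqP ->.
- by move/eqP.
Qed.

Lemma adjR b i z : adj (NR b i) z ->
  match z with
  | NX b' i' _ => b' = b /\ i' = i
  | NZ k => k = i :> nat
  | _ => False
  end.
Proof.
rewrite /adj; case: z => [b' i' k'|b' i'|b' k'|b'|b' j'|k'|] //=; rewrite ?orbF.
- by case/andP => /eqP -> /eqP ->.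
- by move/eqP.
Qed.

Lemma adjY b k z : adj (NY b k) z ->
  match z with
  | NY b' k' => b' = b /\ (par k k' \/ par k' k)
  | NH b' => b' = b
  | NV => True
  | _ => False
  end.
Proof.
rewrite /adj; case: z => [b' i' k'|b' i'|b' k'|b'|b' j'|k'|] //=; rewrite ?orbF.
- case/orP => /andP[/eqP -> ?]; split => //; [by left|by right].
- by move/eqP.
Qed.

Lemma adjH b z : adj (NH b) z ->
  match z with NY b' _ | NW b' _ => b' = b | _ => False end.
Proof.
by rewrite /adj; case: z => [b' i' k'|b' i'|b' k'|b'|b' j'|k'|] //= /eqP.
Qed.

Lemma adjW b j z : adj (NW b j) z ->
  match z with
  | NX b' i k => [/\ b' = b, i = j :> nat & k = 0%N :> nat]
  | NH b' => b' = b
  | NW b' _ => b' = b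
  | _ => False
  end.
Proof.
rewrite /adj; case: z => [b' i' k'|b' i'|b' k'|b'|b' j'|k'|] //=; rewrite ?orbF.
- by case/and3P => /eqP ? /eqP ? /eqP ?.
- by move/eqP.
- by case/orP => /andP[/eqP ->].
Qed.

Lemma adjZ k z : adj (NZ k) z ->
  match z with
  | NR _ i => i = k :> nat
  | NZ k' => par k k' \/ par k' k
  | NV => True
  | _ => False
  end.
Proof.
rewrite /adj; case: z => [b' i' k'|b' i'|b' k'|b'|b' j'|k'|] //=; rewrite ?orbF.
- by move/eqP.
- by case/orP; [left|right].
Qed.

(** A heap vertex has at most a parent and two children, plus at most three others: R_i, V and a W
    vertex for X; H and V for Y; the two R_i and V for Z. *)
Lemma adj_low_card x : low x -> (#|[set z | adj x z]| <= 6)%N.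
Proof.
(* Codes the heap neighbours of [k]: 0 is the parent, 1 and 2 are the odd and the even child. The
   larger codes are left for neighbours outside the heap. *)
pose c (k k' : nat) := if (k' < k)%N then 0%N else if odd k' then 1%N else 2%N.
have c_inj k k1 k2 : par k k1 \/ par k1 k -> par k k2 \/ par k2 k ->
    c k k1 = c k k2 -> k1 = k2.
  rewrite /par /c => h1 h2.
  case: (ltnP k1 k) => ?; case: (ltnP k2 k) => ?;
    case: (boolP (odd k1)) => ?; case: (boolP (odd k2)) => ? //= _; lia.
have c_lt k k' : (c k k' < 3)%N by rewrite /c; case: ifP => // _; case: ifP.
have c_ne k k' n : c k k' = n -> (n < 3)%N by move=> <-.
case: x => [b i k|//|b k|//|//|k|//] _.
- pose f z := match z with
    NX _ _ k' => c k k' | NR _ _ => 3%N | NV => 4%N | _ => 5%N end.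
  apply: (@card_le_code _ _ f) => [z1 z2|z _]; last first.
    by case: z => //= *; apply: leq_trans (c_lt _ _) _.
  rewrite !inE => /adjX A1 /adjX A2; case: z1 A1 => [b1 i1 k1|b1 i1|b1 k1|b1|b1 j1|k1|] // A1;
    case: z2 A2 => [b2 i2 k2|b2 i2|b2 k2|b2|b2 j2|k2|] //= A2 E;
    try by [have := c_ne _ _ _ E|have := c_ne _ _ _ (esym E)].
  + case: A1 A2 E => -> -> A1 [-> -> A2] /(c_inj _ _ _ A1 A2) E.
    by congr NX; exact: val_inj.
  + by case: A1 A2 => -> -> [-> ->].
  + by case: A1 A2 => -> E1 _ [-> E2 _]; congr NW; apply: val_inj; rewrite /= E1.
- pose f z := match z with NY _ k' => c k k' | NH _ => 3%N | _ => 4%N end.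
  apply: (@card_le_code _ _ f) => [z1 z2|z _]; last first.
    by case: z => //= *; apply: leq_trans (c_lt _ _) _.
  rewrite !inE => /adjY A1 /adjY A2; case: z1 A1 => [b1 i1 k1|b1 i1|b1 k1|b1|b1 j1|k1|] // A1;
    case: z2 A2 => [b2 i2 k2|b2 i2|b2 k2|b2|b2 j2|k2|] //= A2 E;
    try by [have := c_ne _ _ _ E|have := c_ne _ _ _ (esym E)].
  + case: A1 A2 E => -> A1 [-> A2] /(c_inj _ _ _ A1 A2) E.
    by congr NY; exact: val_inj.
  + by rewrite A1 A2.
- pose f z := match z with
    NZ k' => c k k' | NR b _ => if b then 3%N else 4%N | _ => 5%N end.
  apply: (@card_le_code _ _ f) => [z1 z2|z _]; last first.
    by case: z => //= [b *|*]; [case: b|apply: leq_trans (c_lt _ _) _].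
  rewrite !inE => /adjZ A1 /adjZ A2; case: z1 A1 => [b1 i1 k1|b1 i1|b1 k1|b1|b1 j1|k1|] // A1;
    case: z2 A2 => [b2 i2 k2|b2 i2|b2 k2|b2|b2 j2|k2|] //= A2 E;
    try by [have := c_ne _ _ _ E|have := c_ne _ _ _ (esym E)|
      case: b1 E => /esym/c_ne|case: b2 E => /c_ne|
      case: b1 E|case: b2 E].
  + have -> : i1 = i2 by apply: val_inj; rewrite /= A1.
    by case: b1 b2 E => [] [].
  + by congr NZ; apply: val_inj; exact: c_inj E.
Qed.

Lemma adjR_card_le b i : (#|[set z | adj (NR b i) z]| <= m.+1)%N.
Proof.
pose f z := match z with NX _ _ k => k : nat | _ => m end.
apply: (@card_le_code _ _ f) => [z1 z2|z _]; last first.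
  by case: z => //= _ _ k; rewrite ltnS ltnW.
rewrite !inE => /adjR A1 /adjR A2; case: z1 A1 => [b1 i1 k1|b1 i1|b1 k1|b1|b1 j1|k1|] // A1;
  case: z2 A2 => [b2 i2 k2|b2 i2|b2 k2|b2|b2 j2|k2|] //= A2 E.
- by case: A1 A2 => -> -> [-> ->]; congr NX; exact: val_inj.
- by have := ltn_ord k1; rewrite E ltnn.
- by have := ltn_ord k2; rewrite -E ltnn.
- by congr NZ; apply: val_inj; rewrite /= A1.
Qed.

Lemma adjR_card_ge b i : (m <= #|[set z | adj (NR b i) z]|)%N.
Proof.
have inj : injective (NX b i) by move=> k k' [].
rewrite -[X in (X <= _)%N](card_ord m) -(card_imset _ inj).
apply: subset_leq_card; apply/subsetP => _ /imsetP[k _ ->].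
by rewrite inE /adj /= !eqxx.
Qed.

Lemma adjW_card_ge b j : (m * m <= #|[set z | adj (NW b j) z]|)%N.
Proof.
(* The hub takes the place of the vertex itself, so that the clique and the hub supply exactly
   [m * m] neighbours. *)
pose f j' := if j' == j then NH b else NW b j'.
have inj : injective f by rewrite /f => k k'; do 2!case: eqP => [->|_] //; case.
rewrite -[X in (X <= _)%N](card_ord (m * m)) -(card_imset _ inj).
apply: subset_leq_card; apply/subsetP => _ /imsetP[k _ ->].
rewrite inE /f /adj; have [_|kj] := eqVneq k j; first by rewrite /= eqxx.
by rewrite /= kj eqxx orbT.
Qed.

(** Outside the clique there are only the hub and, for [j < m], one root. *)
Lemma adjW_out_card b j :
  (#|[set z | adj (NW b j) z && (if z is NW _ _ then false else true)]| <= 2)%N.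
Proof.
pose f z := match z with NH _ => 0%N | _ => 1%N end.
apply: (@card_le_code _ _ f) => [z1 z2|z _]; last by case: z.
rewrite !inE => /andP[/adjW + +] /andP[/adjW + +].
case: z1 => [b1 i1 k1|b1 i1|b1 k1|b1|b1 j1|k1|] //;
  case: z2 => [b2 i2 k2|b2 i2|b2 k2|b2|b2 j2|k2|] //.
- move=> [-> E1 F1] _ [-> E2 F2] _ _; congr NX; apply: val_inj => /=.
    by rewrite E1.
  by rewrite F1.
- by move=> -> _ -> _.
Qed.

Lemma adj_connect : (0 < m)%N -> forall x y, connect adj x y.
Proof.
move=> m0; have csym := sym_connect_sym adjC.
suff toV x : connect adj x NV.
  by move=> x y; apply: connect_trans (toV x) _; rewrite csym.
have mm0 : (0 < m * m)%N by rewrite muln_gt0 m0.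
have toVX b i k : connect adj (NX b i k) NV.
  case: k => k; elim/ltn_ind: k => -[|k] IH km.
    by apply: connect1; rewrite /adj.
  have k2 : (k./2 < m)%N by lia.
  apply: connect_trans (IH _ _ k2); last by lia.
  by apply: connect1; rewrite /adj /= /par /= !eqxx.
have toVY b k : connect adj (NY b k) NV by apply: connect1.
case: x => [b i k|b i|b k|b|b j|k|]; rewrite ?toVX ?toVY ?connect0 //.
- apply: connect_trans (toVX b i (Ordinal m0)).
  by apply: connect1; rewrite /adj /= !eqxx.
- apply: connect_trans (toVY b (Ordinal mm0)).
  by apply: connect1; rewrite /adj /= !eqxx.
- apply: (@connect_trans _ _ (NH b)); first by apply: connect1; rewrite /adj /= eqxx.
  apply: connect_trans (toVY b (Ordinal mm0)).
  by apply: connect1; rewrite /adj /= !eqxx.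
- exact: connect1.
Qed.

End Node.

(** * Bounds on loads and on the success probability of a hop *)

Section HopBounds.
Variables (R : realType) (V : finType) (e : rel V).
Hypothesis deg_gt0 : forall u, (0 < #|nbrs e u|)%N.
Hypothesis e_sym : symmetric e.
Implicit Types S : {set V}.

Local Notation deg := (rdeg R e).
Local Notation load := (load R e).

(** The possible askers are split into a small set [C1], each member counted as 1, and a set [C2]
    whose large degrees make each member count at most [D^-1]. *)
Lemma load_le S x (C1 C2 : {set V}) (D : R) : 0 < D ->
  (forall y, y \notin S -> e y x -> (y \in C1) || (y \in C2)) ->
  (forall y, y \in C2 -> D <= deg y) ->
  load S x <= 1 + #|C1|%:R + #|C2|%:R / D.
Proof.
move=> D0 C12 DC2; rewrite -addrA lerD2l.
have inv_ge0 y : 0 <= (deg y)^-1 by rewrite invr_ge0 ltW ?deg_pos.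
apply: (@le_trans _ _ (\sum_(y in C1 :|: C2) (deg y)^-1)).
  rewrite big_mkcond [X in _ <= X]big_mkcond; apply: ler_sum => y _.
  case: ifP => [/andP[yS eyx]|_]; last by case: ifP.
  by rewrite inE C12.
apply: (@le_trans _ _ (\sum_(y in C1) (deg y)^-1 + \sum_(y in C2) (deg y)^-1)).
  rewrite big_mkcond [X in _ <= X + _]big_mkcond [X in _ <= _ + X]big_mkcond.
  rewrite -big_split; apply: ler_sum => y _ /=; rewrite inE.
  by case: (y \in C1); case: (y \in C2); rewrite /= ?addr0 ?add0r // lerDl.
apply: lerD.
  rewrite -sum1_card natr_sum; apply: ler_sum => y _.
  by rewrite invf_le1 ?deg_pos ?deg_ge1.
rewrite -sum1_card natr_sum mulr_suml; apply: ler_sum => y yC.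
by rewrite mul1r lef_pV2 ?posrE ?deg_pos ?DC2.
Qed.

Lemma load_le_deg S x : load S x <= 1 + deg x.
Proof.
have := @load_le S x (nbrs e x) set0 1 ltr01 _ _.
rewrite cards0 mul0r addr0; apply => y; last by rewrite inE.
by rewrite inE orbC inE e_sym => _ ->; rewrite orbT.
Qed.

Lemma hop_ge S y (B : {set V}) (a d : R) : B \subset S ->
  (forall x, x \in B -> e y x) -> (forall x, x \in B -> load S x <= a) ->
  deg y <= d -> 0 < a -> a * d <= 200 * #|B|%:R ->
  1 / 200 <= \sum_(x in S | e y x) (deg y * load S x)^-1.
Proof.
move=> BS eB loadB degy a0 adB.
have dy0 := deg_pos R deg_gt0 y; have d0 : 0 < d by apply: lt_le_trans degy.
apply: (@le_trans _ _ (\sum_(x in B) (d * a)^-1)).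
  rewrite sumr_const -[X in _ <= X]mulr_natl ler_pdivlMr ?mulr_gt0 //.
  lra.
rewrite big_mkcond [X in _ <= X]big_mkcond; apply: ler_sum => x _.
have l0 : 0 < load S x by rewrite (lt_le_trans ltr01) ?load_ge1.
case: ifP => xB; last by case: ifP => // _; rewrite invr_ge0 ltW ?mulr_gt0.
rewrite (subsetP BS) // eB //= lef_pV2 ?posrE ?mulr_gt0 //.
by apply: ler_pM (ltW dy0) (ltW l0) degy (loadB _ xB).
Qed.

Lemma hits_ge S x (B : {set V}) (a d : R) :
  (forall y, y \in B -> e y x) -> (forall y, y \in B -> deg y <= d) ->
  load S x <= a -> 0 < d -> a * d <= 200 * #|B|%:R ->
  1 / 200 <= \sum_(y in B | e y x) (deg y * load S x)^-1.
Proof.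
move=> eB degB loadx d0 adB.
have l0 : 0 < load S x by rewrite (lt_le_trans ltr01) ?load_ge1.
have a0 : 0 < a by apply: lt_le_trans loadx.
apply: (@le_trans _ _ (\sum_(y in B) (d * a)^-1)).
  rewrite sumr_const -[X in _ <= X]mulr_natl ler_pdivlMr ?mulr_gt0 //.
  lra.
rewrite big_mkcond [X in _ <= X]big_mkcond; apply: ler_sum => y _.
case: ifP => yB //=; rewrite eB // lef_pV2 ?posrE ?mulr_gt0 ?deg_pos //.
by apply: ler_pM (ltW _) (ltW l0) (degB _ yB) loadx; rewrite deg_pos.
Qed.

End HopBounds.

(** * Degrees and loads in the graph *)

Section Graph.
Variables (R : realType) (m : nat) (V : finType).
Variables (enc : node m -> V) (dec : V -> node m).
Hypotheses (encK : cancel enc dec) (decK : cancel dec enc).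
Hypothesis m_gt0 : (0 < m)%N.

Implicit Types S : {set V}.

(** The graph is transported along a bijection, since the theorem wants the vertices in an ordinal
    type. *)
Definition edge : rel V := fun x y => adj (dec x) (dec y).

Local Notation M := (m * m)%N.

Lemma edge_enc a b : edge (enc a) (enc b) = adj a b.
Proof. by rewrite /edge !encK. Qed.

Lemma edge_sym : symmetric edge.
Proof. by move=> x y; rewrite /edge adjC. Qed.

Lemma edge_irr : irreflexive edge.
Proof. by move=> x; rewrite /edge adj_irr. Qed.

Lemma edge_connect x y : connect edge x y.
Proof.
have toe p a : path (@adj m) a p -> path edge (enc a) (map enc p).
  by elim: p a => //= b p IH a /andP[ab /IH ->]; rewrite edge_enc ab.
have /connectP[p ap lp] := adj_connect m_gt0 (dec x) (dec y).
apply/connectP; exists (map enc p); first by have := toe _ _ ap; rewrite decK.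
by rewrite -[x]decK last_map -lp decK.
Qed.

Lemma card_nbrs a : #|nbrs edge (enc a)| = #|[set z | adj a z]|.
Proof.
rewrite -(card_imset _ (can_inj encK)); apply: eq_card => y.
apply/idP/imsetP => [|[z + ->]]; rewrite !inE; last by rewrite edge_enc.
by move=> ay; exists (dec y); rewrite ?decK // inE -edge_enc decK.
Qed.

Lemma M_gt0 : (0 < M)%N. Proof. by rewrite muln_gt0 m_gt0. Qed.

Definition i0 : 'I_m := Ordinal m_gt0.
Definition k0 : 'I_M := Ordinal M_gt0.

Lemma nbrs_gt0 u : (0 < #|nbrs edge u|)%N.
Proof.
suff [z uz] : exists z, adj (dec u) z.
  by apply/card_gt0P; exists (enc z); rewrite inE -[u]decK edge_enc.
case: (dec u) => [b i k|b i|b k|b|b j|k|].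
- by exists (NR b i); rewrite /adj /= !eqxx.
- by exists (NX b i i0); rewrite /adj /= !eqxx.
- by exists (NV m).
- by exists (NY b k0); rewrite /adj /= !eqxx.
- by exists (NH m b); rewrite /adj /= !eqxx.
- by exists (NV m).
- by exists (NZ k0).
Qed.

Lemma cardV_le : (#|V| <= 12 * M)%N.
Proof.
rewrite (bij_eq_card (Bijective decK encK)) card_node.
have := m_gt0; nia.
Qed.

Local Notation deg := (rdeg R edge).
Local Notation load := (load R edge).

Lemma deg_le u : deg u <= (12 * M)%:R.
Proof. by rewrite ler_nat (leq_trans (max_card _)) // cardV_le. Qed.

Lemma deg_low a : low a -> deg (enc a) <= 6.
Proof. by move=> la; rewrite /rdeg card_nbrs ler_nat adj_low_card. Qed.

Lemma load_low S a : low a -> load S (enc a) <= 7.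
Proof.
move=> la; apply: le_trans (load_le_deg _ nbrs_gt0 edge_sym _ _) _.
by have := deg_low la; lra.
Qed.

Lemma M_ge1 : 1 <= M%:R :> R. Proof. by rewrite ler1n M_gt0. Qed.

Lemma load_any S u : load S u <= 13 * M%:R.
Proof.
apply: le_trans (load_le_deg _ nbrs_gt0 edge_sym _ _) _.
by have := deg_le u; have := M_ge1; rewrite natrM; lra.
Qed.

Lemma degR_le b i : deg (enc (NR b i)) <= m.+1%:R.
Proof. by rewrite /rdeg card_nbrs ler_nat adjR_card_le. Qed.

Lemma degR_ge b i : m%:R <= deg (enc (NR b i)).
Proof. by rewrite /rdeg card_nbrs ler_nat adjR_card_ge. Qed.

Lemma degW_ge b j : M%:R <= deg (enc (NW b j)).
Proof. by rewrite /rdeg card_nbrs ler_nat adjW_card_ge. Qed.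

Lemma edgeP y a : edge y (enc a) -> exists2 z, y = enc z & adj a z.
Proof. by move=> ya; exists (dec y); rewrite ?decK // adjC -edge_enc decK. Qed.

Local Notation X b i k := (enc (NX b i k)).
Local Notation Rr b i := (enc (NR b i)).
Local Notation Y b k := (enc (NY b k)).
Local Notation H b := (enc (NH m b)).
Local Notation W b j := (enc (NW b j)).
Local Notation Z k := (enc (NZ k)).
Local Notation Vv := (enc (NV m)).

Definition allX b i := [set X b i k | k : 'I_m].
Definition allY b := [set Y b k | k : 'I_M].
Definition allW b := [set W b j | j : 'I_M].
Definition allZ := [set Z k | k : 'I_M].

Lemma card_family n (f : 'I_n -> node m) : injective f ->
  #|[set enc (f k) | k : 'I_n]| = n.
Proof.
move=> finj; rewrite card_imset ?card_ord // => k k' /(can_inj encK).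
exact: finj.
Qed.

Lemma card_allX b i : #|allX b i| = m.
Proof. by apply: card_family => k k' []. Qed.
Lemma card_allY b : #|allY b| = M.
Proof. by apply: card_family => k k' []. Qed.
Lemma card_allW b : #|allW b| = M.
Proof. by apply: card_family => k k' []. Qed.
Lemma card_allZ : #|allZ| = M.
Proof. by apply: card_family => k k' []. Qed.

(** The [M] clique vertices have degree at least [M] and together add at most 1; the hub and a root
    add at most 2. *)
Lemma load_W S b j : load S (W b j) <= 4.
Proof.
pose out := [set z | adj (NW b j) z && (if z is NW _ _ then false else true)].
have M0 : 0 < M%:R :> R by rewrite ltr0n M_gt0.
apply: le_trans (load_le nbrs_gt0 (C1 := enc @: out) (C2 := allW b) M0 _ _) _.
- move=> y _ /edgeP[z -> Wz]; have [zo|] := boolP (z \in out).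
    by rewrite imset_f.
  rewrite inE Wz /=; case: z Wz => // b' j' /adjW -> _.
  by apply/orP; right; rewrite imset_f.
- by move=> _ /imsetP[j' _ ->]; exact: degW_ge.
- rewrite card_imset; last exact: can_inj encK.
  rewrite card_allW divff ?gt_eqF //.
  have : #|out|%:R <= 2 :> R by rewrite ler_nat adjW_out_card.
  lra.
Qed.

(** With X_i fully informed, only the Z partner can still ask R_i. This is why the whole heap is
    informed before R_i is used as a bridge; the same holds for Y and H below. *)
Lemma load_R S b i : allX b i \subset S -> load S (Rr b i) <= 2.
Proof.
move=> XS.
pose C := [set Z k | k in [set k : 'I_M | k == i :> nat]].
apply: le_trans (load_le nbrs_gt0 (C1 := C) (C2 := set0) (@ltr01 R) _ _) _.
- move=> y yS /edgeP[z Ey /adjR]; move: yS; rewrite {y}Ey.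
  case: z => // [b' i' k yS [E1 E2]|k _ ki].
    by case/negP: yS; apply: (subsetP XS); rewrite E1 E2 imset_f.
  by rewrite imset_f // inE ki.
- by move=> y; rewrite inE.
- rewrite cards0 mul0r addr0.
  have : (#|C| <= 1)%N.
    apply: leq_trans (leq_imset_card _ _) _.
    by apply/card_le1_eqP => k k'; rewrite !inE => /eqP E /eqP E'; apply: val_inj; rewrite /= E.
  by rewrite -(ler_nat R); lra.
Qed.

Lemma load_H S b : allY b \subset S -> load S (H b) <= 2.
Proof.
move=> YS; have M0 : 0 < M%:R :> R by rewrite ltr0n M_gt0.
apply: le_trans (load_le nbrs_gt0 (C1 := set0) (C2 := allW b) M0 _ _) _.
- move=> y yS /edgeP[z Ey /adjH]; move: yS; rewrite {y}Ey.
  case: z => // [b' k yS E|b' j _ E].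
    by case/negP: yS; apply: (subsetP YS); rewrite E imset_f.
  by rewrite E inE imset_f ?orbT.
- by move=> _ /imsetP[j' _ ->]; exact: degW_ge.
- by rewrite cards0 card_allW divff ?gt_eqF //; lra.
Qed.

End Graph.

(** * Phases of the random protocol: hops, cliques and heaps *)

Section Phases.
Variables (R : realType) (V : finType) (e : rel V).
Hypothesis deg_gt0 : forall u, (0 < #|nbrs e u|)%N.
Variables (n L tau : nat).
Hypotheses (n_gt0 : (0 < n)%N) (n_le : (n <= 2 ^ L)%N).
Implicit Types (S : {set V}) (A B C : pred {set V}).

Local Notation deg := (rdeg R e).
Local Notation load := (load R e).
Local Notation leads := (leads (rand_trans R e 0)).

Definition miss : R := (1 - 1 / 200) ^+ tau.

Lemma miss_ge0 : 0 <= miss. Proof. by rewrite exprn_ge0 //; lra. Qed.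

(* Every hop in the graph succeeds with probability at least 1/200 per round,
   so [miss] bounds the probability that it fails during [tau] rounds.  The unit
   of time is what a heap of height [L] needs, and the unit of failure
   probability is a union bound over the [L] hops to each of [n] vertices. *)
Definition phase a A B :=
  leads (a * (L.+1 * tau)) ((a * (n * L.+1))%:R * miss) A B.

Definition knows_all (D : {set V}) : pred {set V} := fun S => D \subset S.

Definition knows (y : V) : pred {set V} := fun S => y \in S.

Lemma upclosed_knows_all D : upclosed (knows_all D).
Proof. by move=> S S' SS' DS; exact: subset_trans SS'. Qed.

Lemma upclosed_knows y : upclosed (knows y).
Proof. by move=> S S' /subsetP; apply. Qed.

Lemma upclosedI A B : upclosed A -> upclosed B -> upclosed (fun S => A S && B S).
Proof. by move=> Au Bu S S' SS' /andP[/(Au S S' SS') -> /(Bu S S' SS') ->]. Qed.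

Let Q_ge0 := @rand_trans_ge0 R V e 0.
Let Q_sum1 := @rand_trans_sum1 R V e deg_gt0 0.
Let Q_mono := @rand_trans_mono R V e 0.

Lemma phase_trans a b A B C : phase a A B -> phase b B C -> phase (a + b) A C.
Proof.
move=> AB BC; rewrite /phase !mulnDl natrD mulrDl.
by apply: leads_trans AB BC => //; rewrite mulr_ge0 ?miss_ge0.
Qed.

Lemma phase_pre a A A' B : (forall S, A' S -> A S) -> phase a A B -> phase a A' B.
Proof. exact: leads_pre. Qed.

Lemma phase_post a A B B' : (forall S, B S -> B' S) -> phase a A B -> phase a A B'.
Proof. exact: leads_post. Qed.

Lemma phase_le a b A B : upclosed B -> (a <= b)%N -> phase a A B -> phase b A B.
Proof.
move=> Bu ab AB; apply: (leads_mono Q_ge0 Q_sum1 Q_mono Bu (t := a * (L.+1 * tau))).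
  by rewrite leq_mul2r ab orbT.
apply: leads_le AB; apply: ler_wpM2r; first exact: miss_ge0.
by rewrite ler_nat leq_mul2r ab orbT.
Qed.

Lemma phase1 j k A B : upclosed B -> (j <= L.+1)%N -> (k <= n * L.+1)%N ->
  leads (j * tau) (k%:R * miss) A B -> phase 1 A B.
Proof.
move=> Bu jL kn AB; apply: (leads_mono Q_ge0 Q_sum1 Q_mono Bu (t := j * tau)).
  by rewrite mul1n leq_mul2r jL orbT.
apply: leads_le AB; apply: ler_wpM2r; first exact: miss_ge0.
by rewrite ler_nat mul1n.
Qed.

(** A set of informed neighbours of [y] that is large against their loads and the degree of [y]; by
    [hop_ge] it gives success probability at least 1/200. *)
Definition hopping S y := exists (B : {set V}) (a d : R), [/\ B \subset S,
  (forall x, x \in B -> e y x), (forall x, x \in B -> load S x <= a),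
  deg y <= d & 0 < a * d <= 200 * #|B|%:R].

Lemma hop1 A y : upclosed A -> (forall S, A S -> y \notin S -> hopping S y) ->
  leads (1 * tau) (1%:R * miss) A (fun S => A S && (y \in S)).
Proof.
move=> Au hy; rewrite mul1n mul1r.
apply: (leads_hop deg_gt0) => // [|S AS yS]; first by lra.
have [B [a [d [BS eB lB dy /andP[ad0 ad]]]]] := hy S AS yS.
apply: (hop_ge deg_gt0 BS eB lB dy _ ad).
have d0 : 0 < d by apply: lt_le_trans dy; exact: deg_pos.
by rewrite pmulr_lgt0 in ad0.
Qed.

(** The hops to all members of [D] run in parallel during the same [tau] rounds, with a union bound
    over [D]. *)
Lemma phase_hops A (D : {set V}) : upclosed A -> (#|D| <= n)%N ->
  (forall S y, A S -> y \in D -> y \notin S -> hopping S y) ->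
  phase 1 A (fun S => A S && knows_all D S).
Proof.
(* The empty [D] is treated apart: a conjunction over no targets would not return [A S]. *)
move=> Au Dn hD; have [->|D0] := eqVneq D set0.
  apply: (@phase1 0 0) => //; first exact: upclosedI (upclosed_knows_all (D:=_)).
  rewrite mul0r; apply: leads_refl => S ->; rewrite /knows_all; exact: sub0set.
apply: (@phase1 1 #|D|) => //; first exact: upclosedI (upclosed_knows_all (D:=_)).
  by rewrite (leq_trans Dn) // leq_pmulr.
have -> : #|D| = #|[set y | y \in D]| by apply: eq_card => y; rewrite inE.
apply: (leads_post Q_ge0
  (B := fun S => [forall y, (y \in D) ==> A S && (y \in S)])) => [S /forallP ADS|].
  have [y yD] := set0Pn _ D0.
  have /implyP/(_ yD)/andP[-> _] := ADS y.
  by apply/subsetP => z zD; have /implyP/(_ zD)/andP[] := ADS z.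
rewrite -[miss]mul1r.
apply: (leads_forall Q_ge0 (B := fun y S => A S && (y \in S))) => y yD.
by apply: hop1 => // S AS yS; exact: hD.
Qed.

Lemma phase_hop A y : upclosed A -> (forall S, A S -> y \notin S -> hopping S y) ->
  phase 1 A (fun S => A S && (y \in S)).
Proof.
move=> Au hy; apply: (@phase1 1 1) => //; last exact: hop1.
  exact: upclosedI (@upclosed_knows y).
by rewrite muln_gt0 n_gt0.
Qed.

Lemma phase_hits A (B : {set V}) x (a d : R) : upclosed A ->
  (forall S, A S -> x \in S) -> (forall y, y \in B -> e y x) ->
  (forall y, y \in B -> deg y <= d) ->
  (forall S, A S -> load S x <= a) -> 0 < d -> a * d <= 200 * #|B|%:R ->
  phase 1 A (hits B).
Proof.
move=> Au Ax eB dB lx d0 ad.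
apply: (@phase1 1 1) => //; first exact: upclosed_hits.
  by rewrite muln_gt0 n_gt0.
rewrite mul1n mul1r.
apply: (leads_post Q_ge0 (B := fun S => A S && hits B S)) => [S /andP[]//|].
apply: (leads_hits deg_gt0) => // [|S AS _]; first by lra.
exists x; first exact: Ax.
exact: (hits_ge deg_gt0 eB dB (lx S AS) d0 ad).
Qed.

Lemma phase_some a A (B : {set V}) : (forall y, y \in B -> phase a (knows y) A) ->
  phase a (hits B) A.
Proof. by move=> hB; split=> S /existsP[y /andP[yB yS]]; have [+] := hB y yB; apply. Qed.

(** The potential of [leads_half] starts at no more than [n], which costs a factor [n] in the
    failure probability. *)
Lemma phase_half (W : {set V}) : #|W| = n ->
  {in W &, forall x y, x != y -> e x y} ->
  (forall S x, x \in S :&: W -> load S x <= 4) ->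
  (forall y, y \in W -> deg y <= 12 * n%:R) ->
  phase 1 (hits W) (half_of W).
Proof.
move=> Wn clique lW dW; have n0 : 0 < n%:R :> R by rewrite ltr0n.
apply: (@phase1 1 n) => //; first exact: upclosed_half.
  by rewrite leq_pmulr.
rewrite mul1n.
(* Loads at most 4 and degrees at most [12 * n] give decay rate 1/192, which exceeds the 1/200 in
   [miss]. *)
have := @leads_half R V e deg_gt0 tau W 4 (12 * n%:R) clique _ _ lW dW _.
rewrite Wn => H.
apply: leads_le (H _ _ _); last by nra.
- apply: ler_wpM2l => //; apply: lerXn2r; rewrite ?nnegrE; first last.
  + rewrite lerD2l lerN2 ler_pdivlMr; last by nra.
    by lra.
  + lra.
  + rewrite subr_ge0 ler_pdivrMr; nra.
- by [].
- by nra.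
Qed.

(** Induction on the level: passing to the parent halves the index, and every tree edge is a hop in
    both directions because degrees and loads are bounded by 6 and 7. *)
Lemma leads_heap N (h : 'I_N -> V) l (k r : 'I_N) :
  symmetric e -> (forall k k' : 'I_N, par k k' -> e (h k) (h k')) -> (forall k, deg (h k) <= 6) ->
  (forall S k, load S (h k) <= 7) ->
  r = 0%N :> nat -> (k < 2 ^ l)%N ->
  leads (l * tau) (l%:R * miss) (knows (h k)) (knows (h r)) /\
  leads (l * tau) (l%:R * miss) (knows (h r)) (knows (h k)).
Proof.
move=> e_sym eh dh lh r0; elim: l k => [|l IH] k kl.
  have -> : k = r by apply: val_inj; rewrite /= r0; move: kl; rewrite expn0; lia.
  by rewrite mul0n mul0r; split; apply: leads_refl.
have [k0|k0] := posnP k.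
  have -> : k = r by apply: val_inj; rewrite /= r0.
  have miss0 := miss_ge0.
  split; apply: (leads_mono Q_ge0 Q_sum1 Q_mono (upclosed_knows (y:=_)) (leq0n _));
    apply: (@leads_le _ _ _ _ 0); rewrite ?mulr_ge0 //; exact: leads_refl.
have pk : (k.-1./2 < N)%N by have := ltn_ord k; lia.
have kk' : par k (Ordinal pk) by rewrite /par k0 /=.
have [up down] : leads (l * tau) (l%:R * miss) (knows (h (Ordinal pk))) (knows (h r)) /\
  leads (l * tau) (l%:R * miss) (knows (h r)) (knows (h (Ordinal pk))).
  by apply: IH => /=; move: kl; rewrite expnS; lia.
have hop y x : e (h y) (h x) ->
    leads (1 * tau) (1%:R * miss) (knows (h x)) (knows (h y)).
  move=> exy; apply: (leads_post Q_ge0 (B := fun S => knows (h x) S && (h y \in S))).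
    by move=> S /andP[].
  apply: hop1 => [|S xS _]; first exact: upclosed_knows.
  exists [set h x], 7, 6; split => //.
  - by rewrite sub1set.
  - by move=> z; rewrite inE => /eqP ->.
  - by move=> z; rewrite inE => /eqP ->.
  - by rewrite cards1; lra.
have miss0 := miss_ge0.
split.
  rewrite -[l.+1]add1n mulnDl natrD mulrDl.
  apply: (leads_trans Q_ge0 Q_sum1 _ _ up); first by rewrite mulr_ge0.
  by apply: hop; rewrite e_sym eh.
rewrite -[l.+1]addn1 mulnDl natrD mulrDl.
apply: (leads_trans Q_ge0 Q_sum1 _ down); first by rewrite mulr_ge0.
exact/hop/eh.
Qed.

(** First up to the root, then down to all vertices at once; the descent pays a union bound over [N]
    paths of [L] hops. *)
Lemma phase_heap N (h : 'I_N -> V) (k : 'I_N) : (N <= n)%N ->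
  symmetric e -> (forall k k' : 'I_N, par k k' -> e (h k) (h k')) -> (forall k, deg (h k) <= 6) ->
  (forall S k, load S (h k) <= 7) ->
  phase 2 (knows (h k)) (knows_all [set h k' | k' : 'I_N]).
Proof.
move=> Nn e_sym eh dh lh.
have N0 : (0 < N)%N by apply: leq_ltn_trans (ltn_ord k).
pose r := Ordinal N0.
have lt2 (i : 'I_N) : (i < 2 ^ L)%N by rewrite (leq_trans (ltn_ord i)) ?(leq_trans Nn).
have miss0 := miss_ge0.
apply: (@phase_trans 1 1 _ (knows (h r))).
  apply: (@phase1 L L) => //; [exact: upclosed_knows|by rewrite (leq_trans (leqnSn L)) ?leq_pmull|].
  by have [] := leads_heap e_sym eh dh lh (erefl : nat_of_ord r = 0%N) (lt2 k).
apply: (@phase1 L (N * L)) => //; first exact: upclosed_knows_all.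
  by rewrite leq_mul.
have H i := proj2 (leads_heap e_sym eh dh lh (erefl : nat_of_ord r = 0%N) (lt2 i)).
have := leads_forall Q_ge0 (P := xpredT) (fun i _ => H i).
have -> : #|[set i : 'I_N | xpredT i]| = N.
  by rewrite -[RHS](card_ord N); apply: eq_card => i; rewrite inE.
rewrite mulrA -natrM; apply: leads_post => // S /forallP hS.
by apply/subsetP => _ /imsetP[i _ ->]; have := hS i.
Qed.

End Phases.

(** * The random protocol on the graph *)

Section Cycle.
Variables (R : realType) (m : nat) (V : finType).
Variables (enc : node m -> V) (dec : V -> node m).
Hypotheses (encK : cancel enc dec) (decK : cancel dec enc).
Hypothesis m_gt0 : (0 < m)%N.
Variables (L tau : nat).
Local Notation M := (m * m)%N.
Hypothesis M_le : (M <= 2 ^ L)%N.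

Local Notation edge := (edge dec).
Local Notation X b i k := (enc (NX b i k)).
Local Notation Rr b i := (enc (NR b i)).
Local Notation Y b k := (enc (NY b k)).
Local Notation H b := (enc (NH m b)).
Local Notation W b j := (enc (NW b j)).
Local Notation Z k := (enc (NZ k)).
Local Notation Vv := (enc (NV m)).
Local Notation allX := (allX enc).
Local Notation allY := (allY enc).
Local Notation allW := (allW enc).
Local Notation allZ := (allZ enc).
Local Notation ph := (phase R edge M L tau).
Local Notation i0 := (i0 m_gt0).
Local Notation k0 := (k0 m_gt0).

Let gt0 : forall u, (0 < #|nbrs edge u|)%N := nbrs_gt0 encK decK m_gt0.
Let Mgt0 : (0 < M)%N := M_gt0 m_gt0.
Let M1 : 1 <= M%:R :> R := M_ge1 R m_gt0.
Let m1 : 1 <= m%:R :> R. Proof. by rewrite ler1n. Qed.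

Lemma phase_heap_graph N (h : 'I_N -> node m) (k : 'I_N) : (N <= M)%N ->
  (forall k, low (h k)) -> (forall k k' : 'I_N, par k k' -> link (h k) (h k')) ->
  ph 2 (knows (enc (h k))) (knows_all [set enc (h k') | k' : 'I_N]).
Proof.
move=> NM lowh arch.
apply: (@phase_heap R _ _ gt0 _ _ tau Mgt0 M_le _ (fun k => enc (h k)) k NM).
- exact: edge_sym.
- by move=> k1 k2 /arch k12; rewrite (edge_enc encK) /adj k12.
- by move=> k1; apply: (deg_low R encK decK).
- by move=> S k1; apply: (load_low R encK decK m_gt0).
Qed.

Lemma m_le_M : (m <= M)%N. Proof. by rewrite leq_pmull. Qed.

Lemma phase_X b i k : ph 2 (knows (X b i k)) (knows_all (allX b i)).
Proof.
apply: (phase_heap_graph (h := NX b i)) => //; first exact: m_le_M.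
by move=> k1 k2 /=; rewrite !eqxx.
Qed.

Lemma phase_Y b k : ph 2 (knows (Y b k)) (knows_all (allY b)).
Proof. by apply: (phase_heap_graph (h := NY b)) => // k1 k2 /=; rewrite eqxx. Qed.

Lemma phase_Z k : ph 2 (knows (Z k)) (knows_all allZ).
Proof. exact: (phase_heap_graph (h := @NZ m)). Qed.

Lemma knows_all_knows (I : finType) (f : I -> V) i S :
  knows_all [set f i | i : I] S -> knows (f i) S.
Proof. by move/subsetP; apply; rewrite imset_f. Qed.

Lemma phase_hop_post (A B : pred {set V}) y : upclosed A ->
  (forall S, A S -> y \notin S -> hopping R edge S y) ->
  (forall S, A S -> y \in S -> B S) -> ph 1 A B.
Proof.
move=> Au hy AB; apply: (phase_post (B := fun S => A S && (y \in S))).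
  by move=> S /andP[]; exact: AB.
exact: phase_hop.
Qed.

(** V has degree of order [M], but once all [M] vertices of Z are informed, V asks one of them with
    constant probability. *)
Lemma phase_Z_V k : ph 3 (knows (Z k)) (knows Vv).
Proof.
apply: (phase_trans gt0 (a := 2) (b := 1) (phase_Z k)).
apply: (phase_hop_post (y := Vv)) => // [|S ZS _]; first exact: upclosed_knows_all.
exists allZ, 7, (12 * M%:R); split => //.
- by move=> _ /imsetP[k' _ ->]; rewrite (edge_enc encK).
- by move=> _ /imsetP[k' _ ->]; apply: (load_low R encK decK m_gt0).
- by rewrite -natrM; apply: (deg_le R encK decK m_gt0).
- by rewrite (card_allZ encK); move: M1 m1; lra.
Qed.

Definition zi (i : 'I_m) : 'I_M := widen_ord m_le_M i.

Lemma phase_X_R b i :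
  ph 1 (knows_all (allX b i)) (fun S => knows_all (allX b i) S && knows (Rr b i) S).
Proof.
apply: (phase_hop gt0) => // [|S XS _]; first exact: upclosed_knows_all.
exists (allX b i), 7, m.+1%:R; split => //.
- by move=> _ /imsetP[k' _ ->]; rewrite (edge_enc encK) /adj /= !eqxx.
- by move=> _ /imsetP[k' _ ->]; apply: (load_low R encK decK m_gt0).
- exact: degR_le.
- by rewrite (card_allX encK) -[m.+1%:R]natr1; move: M1 m1; lra.
Qed.

Lemma phase_X_Z b i : ph 2 (knows_all (allX b i)) (knows (Z (zi i))).
Proof.
apply: (phase_trans gt0 (a := 1) (b := 1) (phase_X_R b i)).
apply: (phase_hop_post (y := Z (zi i))) => // [|S /andP[XS RS] _].
  exact: upclosedI (@upclosed_knows_all _ _) (@upclosed_knows _ _).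
exists [set Rr b i], 2, 6; split => //.
- by rewrite sub1set.
- by move=> _ /set1P ->; rewrite (edge_enc encK) /adj /= eqxx.
- by move=> _ /set1P ->; exact: load_R.
- exact: (deg_low R encK decK).
- by rewrite cards1; move: M1 m1; lra.
Qed.

Lemma phase_X_V b i k : ph 7 (knows (X b i k)) (knows Vv).
Proof.
apply: (phase_trans gt0 (a := 2) (b := 5) (phase_X b i k)).
exact: (phase_trans gt0 (a := 2) (b := 3) (phase_X_Z b i) (phase_Z_V _)).
Qed.

(** R_i may receive up to [m.+1] requests, but the [m] heap vertices each ask it with constant
    probability, and it suffices that some one of them is served. *)
Lemma phase_R_V b i : ph 8 (knows (Rr b i)) (knows Vv).
Proof.
apply: (phase_trans gt0 (a := 1) (b := 7) (B := hits (allX b i))); last first.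
  by apply: phase_some => _ /imsetP[k _ ->]; exact: phase_X_V.
apply: (phase_hits gt0 L tau Mgt0 (x := Rr b i) (a := m%:R + 2) (d := 6)) => //.
- exact: upclosed_knows.
- by move=> _ /imsetP[k' _ ->]; rewrite (edge_enc encK) /adj /= !eqxx.
- by move=> _ /imsetP[k' _ ->]; apply: (deg_low R encK decK).
- move=> S _; apply: le_trans (load_le_deg R gt0 (edge_sym dec) _ _) _.
  by have := degR_le R encK decK b i; rewrite -[m.+1%:R]natr1; move: M1 m1; lra.
- by rewrite (card_allX encK); move: M1 m1; lra.
Qed.

Lemma phase_Y_H b :
  ph 1 (knows_all (allY b)) (fun S => knows_all (allY b) S && knows (H b) S).
Proof.
apply: (phase_hop gt0) => // [|S YS _]; first exact: upclosed_knows_all.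
exists (allY b), 7, (12 * M%:R); split => //.
- by move=> _ /imsetP[k' _ ->]; rewrite (edge_enc encK) /adj /= eqxx.
- by move=> _ /imsetP[k' _ ->]; apply: (load_low R encK decK m_gt0).
- by rewrite -natrM; apply: (deg_le R encK decK m_gt0).
- by rewrite (card_allY encK); move: M1 m1; lra.
Qed.

(** With Y informed only clique vertices still ask H, so H soon serves one of them. *)
Lemma phase_Y_W b k : ph 4 (knows (Y b k)) (hits (allW b)).
Proof.
apply: (phase_trans gt0 (a := 2) (b := 2) (phase_Y b k)).
apply: (phase_trans gt0 (a := 1) (b := 1) (phase_Y_H b)).
apply: (phase_hits gt0 L tau Mgt0 (x := H b) (a := 2) (d := 12 * M%:R)) => //.
- exact: upclosedI (@upclosed_knows_all _ _) (@upclosed_knows _ _).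
- by move=> S /andP[].
- by move=> _ /imsetP[k' _ ->]; rewrite (edge_enc encK) /adj /= eqxx.
- by move=> y _; rewrite -natrM; apply: (deg_le R encK decK m_gt0).
- by move=> S /andP[YS _]; exact: load_H.
- by move: M1; lra.
- by rewrite (card_allW encK); move: M1 m1; lra.
Qed.

(** After half of the clique is informed, every other clique vertex asks that half with constant
    probability. *)
Lemma phase_allW b : ph 2 (hits (allW b)) (knows_all (allW b)).
Proof.
have ldW S x : x \in allW b -> load R edge S x <= 4.
  by move=> /imsetP[j _ ->]; apply: (load_W R encK decK m_gt0).
have clique : {in allW b &, forall x y, x != y -> edge x y}.
  move=> _ _ /imsetP[j _ ->] /imsetP[j' _ ->] jj'.
  rewrite (edge_enc encK) /adj /= eqxx /=.
  by apply/orP; left; apply: contraNneq jj' => ->.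
have dgW y : rdeg R edge y <= 12 * M%:R.
  by rewrite -natrM; apply: (deg_le R encK decK m_gt0).
apply: (phase_trans gt0 (a := 1) (b := 1) (B := half_of (allW b))).
  apply: phase_half => //; first by rewrite (card_allW encK).
  by move=> S x /setIP[_]; exact: ldW.
apply: (phase_post (B := fun S => half_of (allW b) S && knows_all (allW b) S)).
  by move=> S /andP[].
apply: phase_hops => //; [exact: upclosed_half|by rewrite (card_allW encK)|].
move=> S y hS yW yS; exists (S :&: allW b), 4, (12 * M%:R); split => //.
- exact: subsetIl.
- by move=> x /setIP[xS xW]; apply: clique => //; apply: contraNneq yS => ->.
- by move=> x /setIP[_]; exact: ldW.
- move: hS; rewrite /half_of (card_allW encK) -(ler_nat R) [T in _ <= T]natrM.
  by move: M1; lra.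
Qed.

Lemma phase_W_X b i : ph 1 (knows_all (allW b)) (knows (X b i i0)).
Proof.
apply: (phase_hop_post (y := X b i i0)) => // [|S WS _].
  exact: upclosed_knows_all.
exists [set W b (zi i)], 4, 6; split => //.
- by rewrite sub1set; exact: (knows_all_knows (f := fun j => W b j) (zi i) WS).
- by move=> _ /set1P ->; rewrite (edge_enc encK) /adj /= !eqxx.
- by move=> _ /set1P ->; apply: (load_W R encK decK m_gt0).
- exact: (deg_low R encK decK).
- by rewrite cards1; move: M1 m1; lra.
Qed.

Lemma phase_W_V b : ph 10 (hits (allW b)) (knows Vv).
Proof.
apply: (phase_trans gt0 (a := 2) (b := 8) (phase_allW b)).
exact: (phase_trans gt0 (a := 1) (b := 7) (phase_W_X b i0) (phase_X_V _ _ _)).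
Qed.

Lemma phase_Y_V b k : ph 14 (knows (Y b k)) (knows Vv).
Proof. exact: (phase_trans gt0 (a := 4) (b := 10) (phase_Y_W b k) (phase_W_V b)). Qed.

(** Here the random choice matters: the load of [x] may be of order [M], but [M] vertices of Y ask
    with constant probability each, so they get a constant share of the service. Used for V and for
    H. *)
Lemma phase_to_Y b x : (forall k : 'I_M, edge (Y b k) x) ->
  ph 1 (knows x) (hits (allY b)).
Proof.
move=> ex.
apply: (phase_hits gt0 L tau Mgt0 (x := x) (a := 13 * M%:R) (d := 6)) => //.
- exact: upclosed_knows.
- by move=> _ /imsetP[k' _ ->].
- by move=> _ /imsetP[k' _ ->]; apply: (deg_low R encK decK).
- by move=> S _; apply: (load_any R encK decK m_gt0).
- by rewrite (card_allY encK); move: M1 m1; lra.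
Qed.

Lemma phase_H_V b : ph 15 (knows (H b)) (knows Vv).
Proof.
apply: (phase_trans gt0 (a := 1) (b := 14) (B := hits (allY b))).
  by apply: phase_to_Y => k; rewrite (edge_enc encK) /adj /= eqxx.
by apply: phase_some => _ /imsetP[k _ ->]; exact: phase_Y_V.
Qed.

(** The longest route starts at H and takes 1 + 4 + 10 phases, through Y and W. *)
Lemma phase_any_V s : ph 15 (knows s) (knows Vv).
Proof.
have le a (A : pred {set V}) :
    (a <= 15)%N -> ph a A (knows Vv) -> ph 15 A (knows Vv).
  by apply: (phase_le gt0); exact: upclosed_knows.
rewrite -[s]decK; case: (dec s) => [b i k|b i|b k|b|b j|k|].
- exact: le (phase_X_V b i k).
- exact: le (phase_R_V b i).
- exact: le (phase_Y_V b k).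
- exact: phase_H_V.
- apply: (le 10) => //; apply: phase_pre (phase_W_V b) => S wS.
  by apply/existsP; exists (W b j); rewrite imset_f.
- exact: le (phase_Z_V k).
- apply: (le 0) => //; rewrite /phase !mul0n mul0r; exact: leads_refl.
Qed.

Lemma phase_V_allY b : ph 3 (knows Vv) (knows_all (allY b)).
Proof.
apply: (phase_trans gt0 (a := 1) (b := 2) (B := hits (allY b))).
  by apply: phase_to_Y => k; rewrite (edge_enc encK).
by apply: phase_some => _ /imsetP[k _ ->]; exact: phase_Y.
Qed.

Lemma phase_V_hitsY b : ph 1 (knows Vv) (hits (allY b)).
Proof. by apply: phase_to_Y => k; rewrite (edge_enc encK). Qed.

Lemma phase_V_allW b : ph 7 (knows Vv) (knows_all (allW b)).
Proof.
apply: (phase_trans gt0 (a := 1) (b := 6) (phase_V_hitsY b)).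
apply: (phase_trans gt0 (a := 4) (b := 2) _ (phase_allW b)).
by apply: phase_some => _ /imsetP[k _ ->]; exact: phase_Y_W.
Qed.

Lemma phase_V_allX b i : ph 10 (knows Vv) (knows_all (allX b i)).
Proof.
apply: (phase_trans gt0 (a := 7) (b := 3) (phase_V_allW b)).
exact: (phase_trans gt0 (a := 1) (b := 2) (phase_W_X b i) (phase_X _ _ _)).
Qed.

(** The longest route leads to Z, through Y, H, W and X: 10 + 2 + 2 phases. *)
Lemma phase_V_any x : ph 14 (knows Vv) (knows x).
Proof.
have le a (A : pred {set V}) :
    (a <= 14)%N -> ph a A (knows x) -> ph 14 A (knows x).
  by apply: (phase_le gt0); exact: upclosed_knows.
move: le; rewrite -[x]decK; case: (dec x) => [b i k|b i|b k|b|b j|k|] le.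
- by apply: (le 10) => //; apply: phase_post (phase_V_allX b i) => S; exact: knows_all_knows.
- apply: (le 11) => //.
  apply: (phase_trans gt0 (a := 10) (b := 1) (phase_V_allX b i)).
  by apply: phase_post (phase_X_R b i) => S /andP[].
- by apply: (le 3) => //; apply: phase_post (phase_V_allY b) => S; exact: knows_all_knows.
- apply: (le 4) => //.
  apply: (phase_trans gt0 (a := 3) (b := 1) (phase_V_allY b)).
  by apply: phase_post (phase_Y_H b) => S /andP[].
- by apply: (le 7) => //; apply: phase_post (phase_V_allW b) => S; exact: knows_all_knows.
- apply: (phase_trans gt0 (a := 10) (b := 4) (phase_V_allX true i0)).
  apply: (phase_trans gt0 (a := 2) (b := 2) (phase_X_Z _ _)).
  by apply: phase_post (phase_Z (zi i0)) => S; exact: knows_all_knows.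
- by apply: (le 0) => //; rewrite /phase !mul0n mul0r; exact: leads_refl.
Qed.

Lemma leads_all s : leads (rand_trans R edge 0) (29 * (L.+1 * tau))
  ((183 * (M * (M * L.+1)))%:R * miss R tau) (knows s) (pred1 setT).
Proof.
have Q0 := @rand_trans_ge0 R V edge 0.
have Q1 := rand_trans_sum1 R gt0 0.
have miss0 : 0 <= miss R tau by exact: miss_ge0.
have toall := leads_forall Q0 (P := xpredT) (fun x _ => @phase_V_any x).
have cV : #|[set x : V | xpredT x]| = #|V|.
  by apply: eq_card => x; rewrite inE.
rewrite cV in toall.
have := leads_trans Q0 Q1 _ (@phase_any_V s) toall.
rewrite -mulnDl mulrA -natrM -mulrDl -natrD => H.
(* The constant 183 is 15 + 12 * 14: the way to V, then a union bound over at most [12 * M] vertices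
   with 14 phases each. *)
apply: (leads_le (x := (15 * (M * L.+1) + #|V| * (14 * (M * L.+1)))%:R * miss R tau)).
  rewrite ler_wpM2r // ler_nat.
  have := cardV_le encK decK m_gt0; nia.
apply: (leads_post Q0 _ (H _)); last by rewrite mulr_ge0.
move=> S /forallP aS; apply/eqP/setP => x; rewrite inE.
exact: (implyP (aS x)).
Qed.

End Cycle.

(** * The adversarial protocol on the graph *)

Section AdversarialProtocol.
Variables (R : realType) (V : finType) (e : rel V) (A : adversary V).
Hypothesis deg_gt0 : forall u, (0 < #|nbrs e u|)%N.
Implicit Types (S : {set V}) (r : {ffun V -> V}).

Definition adv_next t S r := S :|: [set A t S r v | v in servers S r].

Lemma adv_trans_expect t S (f : {set V} -> R) :
  \sum_S' adv_trans R e A t S S' * f S' =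
  \sum_r req_weight R e S r * f (adv_next t S r).
Proof.
rewrite /adv_trans; under eq_bigr do rewrite mulr_suml.
rewrite exchange_big /=; apply: eq_bigr => r _.
rewrite (bigD1 (adv_next t S r)) //= eqxx mulr1 big1 ?addr0 // => S' /negPf nS'.
by rewrite -/(adv_next t S r) nS' mulr0 mul0r.
Qed.

Lemma adv_trans_ge0 t S S' : 0 <= adv_trans R e A t S S'.
Proof. by apply: sumr_ge0 => r _; rewrite mulr_ge0 // req_weight_ge0. Qed.

Lemma adv_trans_sum1 t S : \sum_S' adv_trans R e A t S S' = 1.
Proof.
transitivity (\sum_S' adv_trans R e A t S S' * 1).
  by apply: eq_bigr => S' _; rewrite mulr1.
rewrite adv_trans_expect -[RHS](req_weight_sum1 R deg_gt0 S).
by apply: eq_bigr => r _; rewrite mulr1.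
Qed.

Lemma req_weight_supp S r u : req_weight R e S r != 0 -> u \notin S -> e u (r u).
Proof.
move=> + uS; apply: contraNT => nu; rewrite /req_weight (bigD1 u) //=.
by rewrite (negPf uS) (negPf nu) !mul0r.
Qed.

Lemma adv_next_new t S r y : valid_adversary A -> y \in adv_next t S r ->
  y \notin S -> exists v, [/\ v \in S, r y = v & y = A t S r v].
Proof.
move=> Av /setUP[->//|/imsetP[v vs ->]] yS; exists v.
have := Av t S r v vs; rewrite inE => /andP[_ /eqP ->]; split => //.
by move: vs; rewrite inE => /andP[].
Qed.

(** Requests are independent, and each [u] in [B] is uninformed and asks [v] with probability at
    least [q^-1]. *)
Lemma req_weight_none S (B : {set V}) v (q : R) : [disjoint B & S] ->
  (forall u, u \in B -> e u v && (rdeg R e u <= q)) ->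
  \sum_r req_weight R e S r * [forall u in B, r u != v]%:R <= (1 - q^-1) ^+ #|B|.
Proof.
move=> BS hB.
have -> : \sum_r req_weight R e S r * [forall u in B, r u != v]%:R =
    \sum_r req_weight R e S r * \prod_(u in B) (r u != v)%:R.
  apply: eq_bigr => r _; congr (_ * _).
  have [/forall_inP allB|] := boolP [forall u in B, r u != v].
    by rewrite big1 // => u /allB ->.
  rewrite negb_forall_in => /exists_inP[u uB]; rewrite negbK => ruv.
  by rewrite (bigD1 u) //= ruv mul0r.
have := sum_ffun_prod B (fun _ x => (x != v)%:R) (ask_sum1 R deg_gt0 S).
rewrite /req_weight => ->; rewrite -prodr_const; apply: ler_prod => u uB.
have uS : u \notin S by rewrite (disjointFr BS uB).
have /andP[euv dq] := hB u uB.
have -> : \sum_x ask R e S u x * (x != v)%:R = 1 - (rdeg R e u)^-1.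
  rewrite -[in RHS](ask_sum1 R deg_gt0 S u) (bigD1 v) //= eqxx mulr0 add0r.
  rewrite [in RHS](bigD1 v) //= {2}/ask (negPf uS) euv mul1r -/(rdeg R e u) addrAC subrr add0r.
  by apply: eq_bigr => x ->; rewrite mulr1.
have d1 := deg_ge1 R deg_gt0 u; have d0 := deg_pos R deg_gt0 u.
rewrite subr_ge0 invf_le1 // d1 /= lerD2l lerN2 lef_pV2 ?posrE //.
exact: lt_le_trans dq.
Qed.

End AdversarialProtocol.

(** The induction runs on the stronger bound with [k + 5]. All that is needed of the exponential
    decay is that it is O(1/k). *)
Lemma geom_five_sixths (R : realType) k : (1 - 6^-1) ^+ k * k%:R <= 5 :> R.
Proof.
suff : (1 - 6^-1) ^+ k * (k%:R + 5) <= 5 :> R.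
  have : 0 <= (1 - 6^-1) ^+ k :> R by apply: exprn_ge0; lra.
  by nra.
elim: k => [|k IH]; first by rewrite expr0 mul1r add0r.
have : 0 <= (1 - 6^-1) ^+ k :> R by apply: exprn_ge0; lra.
have : 0 <= k%:R :> R by [].
by rewrite exprS -[k.+1%:R]natr1; nra.
Qed.

(** * The blocking adversary and the lower bound in the copy [b] *)

Section Slow.
Variables (R : realType) (m : nat) (V : finType).
Variables (enc : node m -> V) (dec : V -> node m).
Hypotheses (encK : cancel enc dec) (decK : cancel dec enc).
Hypothesis m_gt0 : (0 < m)%N.
Variable b : bool.
Implicit Types (S : {set V}) (r : {ffun V -> V}).
Local Notation M := (m * m)%N.
Local Notation edge := (edge dec).
Local Notation i0 := (i0 m_gt0).
Local Notation X i k := (enc (NX b i k)).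
Local Notation Rr i := (enc (NR b i)).
Local Notation Y k := (enc (NY b k)).
Local Notation H := (enc (NH m b)).
Local Notation W j := (enc (NW b j)).
Local Notation Vv := (enc (NV m)).
Local Notation zi := (zi m_gt0).

Let gt0 : forall u, (0 < #|nbrs edge u|)%N := nbrs_gt0 encK decK m_gt0.

Definition roots := [set X i i0 | i : 'I_m].

(** Roots of the X_i in copy [b] have priority at every server; otherwise any request is served. The
    last branch is a default for nodes that receive no request. *)
Definition blocker : adversary V := fun _ S r v =>
  if [pick x in requests S r v :&: roots] is Some x then x
  else if [pick x in requests S r v] is Some x then x else v.

Lemma blocker_valid : valid_adversary blocker.
Proof.
move=> t S r v; rewrite inE card_gt0 => /andP[_ /set0Pn[x xr]]; rewrite /blocker.
case: pickP => [y /setIP[]//|_]; case: pickP => [//|/(_ x)].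
by rewrite xr.
Qed.

Lemma blocker_roots t S r v i : X i i0 \in requests S r v ->
  blocker t S r v \in roots.
Proof.
move=> ri; rewrite /blocker; case: pickP => [y /setIP[]//|/(_ (X i i0))].
by rewrite in_setI ri /= imset_f.
Qed.

(** The part to be kept uninformed. It can be entered only from V into Y, or from the root of some
    X_i into W. *)
Definition target := [set x | match dec x with
  | NY b' _ | NW b' _ | NH b' => b' == b
  | _ => false end].

Definition blob i := [set x | match dec x with
  | NX b' i' _ | NR b' i' => (b' == b) && (i' == i)
  | _ => false end].

Definition ntouched S : nat := \sum_(i < m) hits (blob i) S.

(* [danger] saturates once half of the blobs are touched, because from then on
   it may happen that no root asks V. *)
Definition danger S : R :=
  if hits target S then 1 else Num.min 1 (2 * (ntouched S)%:R / m%:R).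

Lemma hitsP (B S : {set V}) : reflect (exists2 y, y \in B & y \in S) (hits B S).
Proof.
by apply: (iffP existsP) => [[y /andP[]]|[y yB yS]]; exists y => //; rewrite yB.
Qed.

Lemma edgePl y a : edge y (enc a) -> exists2 z, y = enc z & adj z a.
Proof. by case/(edgeP encK decK) => z -> az; exists z; rewrite // adjC. Qed.

Let supported S r := forall u, u \notin S -> edge u (r u).

Definition leak S r i : bool := (Rr i \notin S) && (r (Rr i) == enc (NZ (zi i))).

(** While the target is uninformed, an untouched blob can be entered only at its root from V, or at
    R_i from Z. *)
Lemma touched_next t S r i : supported S r -> ~~ hits target S ->
  (hits (blob i) (adv_next blocker t S r) <=
   hits (blob i) S + (blocker t S r Vv == X i i0) + leak S r i)%N.
Proof.
move=> supp nT; case: hitsP => [[y yb yS']|_] //.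
have [hS|nh] := boolP (hits (blob i) S); first by [].
have yS : y \notin S by apply/negP => yS; case/hitsP: nh; exists y.
have [v [vS ryv yA]] := adv_next_new blocker_valid yS' yS.
have := supp y yS; rewrite ryv -[v]decK => /edgePl[z Ey]; rewrite {}Ey in yb yS ryv yA.
have notin w : enc w \in blob i \/ enc w \in target -> dec v = w -> False.
  by move=> [] + E; rewrite -E decK => wv; [case/hitsP: nh|case/hitsP: nT]; exists v.
move: yb; rewrite !inE encK; case: z yS ryv yA => // [b' i' k|b' i'] yS ryv yA.
- case/andP=> /eqP Eb /eqP Ei; subst b' i' => /adjX; case Ev: (dec v) => [b1 i1 k1|b1 i1|||b1 j1||] //.
  + by case=> E1 E2 _; case: (notin _ _ Ev); left; rewrite inE encK E1 E2 !eqxx.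
  + by case=> E1 E2; case: (notin _ _ Ev); left; rewrite inE encK E1 E2 !eqxx.
  + by case=> E1 _ _; case: (notin _ _ Ev); right; rewrite inE encK E1 eqxx.
  + move=> k0; have -> : (blocker t S r Vv == X i i0) = true.
      rewrite -Ev decK -yA; apply/eqP; congr (enc (NX _ _ _)); exact: val_inj.
    by [].
- case/andP=> /eqP Eb /eqP Ei; subst b' i' => /adjR; case Ev: (dec v) => [b1 i1 k1|||||k1|] //.
  + by case=> E1 E2; case: (notin _ _ Ev); left; rewrite inE encK E1 E2 !eqxx.
  + move=> k1i; rewrite /leak yS ryv -[v]decK Ev (_ : zi i = k1) ?eqxx ?addn1 //.
    by apply: val_inj; rewrite /= k1i.
Qed.

Definition sneak S r i : bool := hits (blob i) S && (r (W (zi i)) == X i i0).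

(** Only untouched blobs are considered, since their roots are certainly uninformed and still send
    requests. *)
Definition quiet S r : bool :=
  [forall u in [set X i i0 | i in [set i | ~~ hits (blob i) S]], r u != Vv].

(** A [W] vertex can only be served by a root, which is a [sneak]. A [Y] vertex can only be served
    by V, and the blocker does this only when no root asks V. *)
Lemma target_next t S r : supported S r -> ~~ hits target S ->
  hits target (adv_next blocker t S r) ->
  (1 <= \sum_(i < m) sneak S r i + quiet S r)%N.
Proof.
move=> supp nT /hitsP[y yT yS'].
have yS : y \notin S by apply/negP => yS; case/hitsP: nT; exists y.
have [v [vS ryv yA]] := adv_next_new blocker_valid yS' yS.
have := supp y yS; rewrite ryv -[v]decK => /edgePl[z Ey]; rewrite {}Ey in yT yS ryv yA.
have notin w : enc w \in target -> dec v = w -> False.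
  by move=> + E; rewrite -E decK => wT; case/hitsP: nT; exists v.
move: yT; rewrite !inE encK; case: z yS ryv yA => // [b' k|b'|b' j] yS ryv yA.
- move/eqP=> Eb; subst b' => /adjY; case Ev: (dec v) => [||b1 k1|b1|||] //.
  + by case=> E1 _; case: (notin _ _ Ev); rewrite inE encK E1 eqxx.
  + by move=> E1; case: (notin _ _ Ev); rewrite inE encK E1 eqxx.
  + move=> _; suff -> : quiet S r by rewrite addn1.
    apply/forall_inP => u /imsetP[i]; rewrite inE => nh ->.
    apply/negP => /eqP riV.
    have : X i i0 \in requests S r v.
      rewrite inE riV -Ev decK eqxx andbT; apply/negP => XS.
      by case/hitsP: nh; exists (X i i0) => //; rewrite inE encK !eqxx.
    by move/(blocker_roots t); rewrite -yA => /imsetP[i' _ /(can_inj encK)].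
- move/eqP=> Eb; subst b' => /adjH; case Ev: (dec v) => [||b1 k1||b1 j1||] // E1;
    by case: (notin _ _ Ev); rewrite inE encK E1 eqxx.
- move/eqP=> Eb; subst b' => /adjW; case Ev: (dec v) => [b1 i1 k1|||b1|b1 j1||] //.
  + case=> E1 E2 E3; rewrite (bigD1 i1) //= (_ : sneak S r i1) //.
    have Ev' : v = X i1 i0.
      by rewrite -[v]decK Ev E1; congr (enc (NX _ _ _)); apply: val_inj.
    rewrite /sneak (_ : zi i1 = j) ?ryv ?Ev' ?eqxx ?andbT; last first.
      by apply: val_inj; rewrite /= E2.
    by apply/hitsP; exists v => //; rewrite inE Ev E1 !eqxx.
  + by move=> E1; case: (notin _ _ Ev); rewrite inE encK E1 eqxx.
  + by move=> E1; case: (notin _ _ Ev); rewrite inE encK E1 eqxx.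
Qed.

Lemma ntouched_next t S r : supported S r -> ~~ hits target S ->
  (ntouched (adv_next blocker t S r) <= ntouched S + 1 + \sum_(i < m) leak S r i)%N.
Proof.
move=> supp nT.
have : (\sum_(i < m) (blocker t S r Vv == X i i0) <= 1)%N.
  rewrite -(ler_nat R) natr_sum.
  apply: le_trans (sum_indicator_le1 _ (P := xpredT) (Q := fun i => blocker t S r Vv == X i i0) _) _.
    by move=> i j _ _ /eqP -> /eqP /(can_inj encK) [].
  by case: [exists _, _].
have : (ntouched (adv_next blocker t S r) <= \sum_(i < m)
    (hits (blob i) S + (blocker t S r Vv == X i i0) + leak S r i))%N.
  by apply: leq_sum => i _; exact: touched_next.
rewrite !big_split /= -/(ntouched S); lia.
Qed.

Let m0 : 0 < m%:R :> R. Proof. by rewrite ltr0n. Qed.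

(** R_i has degree at least [m], so over all [i] at most one leak per round is expected. *)
Lemma leak_pr S i : \sum_r req_weight R edge S r * (leak S r i)%:R <= m%:R^-1.
Proof.
have [RS|RS] := boolP (Rr i \in S).
  by rewrite big1 ?invr_ge0 // => r _; rewrite /leak RS mulr0.
rewrite /leak RS /=; rewrite (req_weight_pr R gt0 _ RS).
apply: (@le_trans _ _ (rdeg R edge (Rr i))^-1).
  by case: (edge _ _); rewrite ?mul1r // mul0r invr_ge0 ltW ?deg_pos.
by rewrite lef_pV2 ?posrE ?deg_pos // (degR_ge R encK decK).
Qed.

Lemma sneak_pr S i : ~~ hits target S ->
  \sum_r req_weight R edge S r * (sneak S r i)%:R <= (hits (blob i) S)%:R / M%:R.
Proof.
move=> nT; rewrite /sneak; case: (hits (blob i) S) => /=; last first.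
  by rewrite mul0r big1 // => r _; rewrite mulr0.
have WS : W (zi i) \notin S.
  by apply/negP => WS; case/hitsP: nT; exists (W (zi i)); rewrite // inE encK.
rewrite (req_weight_pr R gt0 _ WS) mul1r.
apply: (@le_trans _ _ (rdeg R edge (W (zi i)))^-1).
  by case: (edge _ _); rewrite ?mul1r // mul0r invr_ge0 ltW ?deg_pos.
rewrite lef_pV2 ?posrE ?deg_pos ?ltr0n ?muln_gt0 ?m_gt0 //.
exact: (degW_ge R encK decK).
Qed.

Lemma card_untouched S : #|[set i | ~~ hits (blob i) S]| = (m - ntouched S)%N.
Proof.
have -> : [set i | ~~ hits (blob i) S] = ~: [set i | hits (blob i) S].
  by apply/setP => i; rewrite !inE.
rewrite cardsCs setCK card_ord /ntouched; congr (_ - _)%N.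
by rewrite -big_mkcond sum1dep_card.
Qed.

(** At least [m / 2] uninformed roots of degree at most 6 would all have to avoid V;
    [geom_five_sixths] then gives 5 divided by [m / 2]. *)
Lemma quiet_pr S : (2 * ntouched S <= m)%N ->
  \sum_r req_weight R edge S r * (quiet S r)%:R <= 10 / m%:R.
Proof.
move=> nm; set B := [set X i i0 | i in [set i | ~~ hits (blob i) S]].
have cB : #|B| = (m - ntouched S)%N.
  by rewrite card_imset ?card_untouched // => i j /(can_inj encK) [].
have BS : [disjoint B & S].
  apply/pred0P => u /=; apply/negP => /andP[/imsetP[i]].
  rewrite inE => nh -> XS; case/hitsP: nh; exists (X i i0) => //.
  by rewrite inE encK !eqxx.
apply: (@le_trans _ _ ((1 - 6^-1) ^+ #|B|)).
  apply: (req_weight_none gt0 BS) => u /imsetP[i _ ->].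
  by rewrite (edge_enc encK) /=; exact: (deg_low R encK decK).
have B2 : m%:R <= 2 * #|B|%:R :> R by rewrite -natrM ler_nat cB; lia.
have := geom_five_sixths R #|B|.
have : 0 <= (1 - 6^-1) ^+ #|B| :> R by apply: exprn_ge0; lra.
by move=> q0 q5; rewrite ler_pdivlMr //; nra.
Qed.

Lemma danger_ge0 S : 0 <= danger S.
Proof.
by rewrite /danger; case: ifP => _ //; rewrite le_min ler01 /= divr_ge0.
Qed.

Lemma danger_le1 S : danger S <= 1.
Proof. by rewrite /danger; case: ifP => _ //; rewrite ge_min lexx. Qed.

(** In units of [m^-1] the 15 is 2 for the root served by V, 2 for leaks, 1 for sneaks and 10 for a
    quiet round. *)
Lemma danger_drift t S :
  \sum_S' adv_trans R edge blocker t S S' * danger S' <= danger S + 15 / m%:R.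
Proof.
have m0' := m0; have inv0 : 0 < m%:R^-1 :> R by rewrite invr_gt0.
(* A saturated [danger] cannot increase, as it never exceeds 1. *)
have [d1|d1] := leP 1 (danger S).
  apply: (@le_trans _ _ (\sum_S' adv_trans R edge blocker t S S')).
    by apply: ler_sum => S' _; rewrite ler_piMr ?adv_trans_ge0 ?danger_le1.
  by rewrite adv_trans_sum1 // (le_trans d1) // lerDl mulr_ge0 // ltW.
have nT : ~~ hits target S.
  by apply/negP => hT; rewrite /danger hT ltxx in d1.
have dE : danger S = Num.min 1 (2 * (ntouched S)%:R / m%:R).
  by rewrite /danger (negPf nT).
have nm1 : 2 * (ntouched S)%:R / m%:R < 1 :> R.
  by move: d1; rewrite dE gt_min ltxx.
rewrite dE (min_r (ltW nm1)); set n : R := (ntouched S)%:R in nm1 *.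
rewrite adv_trans_expect.
pose f r : R := (2 * n / m%:R + 2 / m%:R) + 2 / m%:R * \sum_i (leak S r i)%:R
   + \sum_i (sneak S r i)%:R + (quiet S r)%:R.
apply: (@le_trans _ _ (\sum_r req_weight R edge S r * f r)).
  apply: ler_sum => r _.
  have [->|nz] := eqVneq (req_weight R edge S r) 0; first by rewrite !mul0r.
  apply: ler_wpM2l; first exact: req_weight_ge0.
  have supp : supported S r by move=> u; exact: req_weight_supp nz.
  have l0 : 0 <= \sum_i (leak S r i)%:R :> R by exact: sumr_ge0.
  have s0 : 0 <= \sum_i (sneak S r i)%:R :> R by exact: sumr_ge0.
  have q0 : 0 <= (quiet S r)%:R :> R by [].
  have n0 : 0 <= n by [].
  rewrite /danger /f; case: ifP => [hT|_].
    have := target_next supp nT hT; rewrite -(ler_nat R) natrD natr_sum => h1.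
    have : 0 <= 2 * n / m%:R + 2 / m%:R + 2 / m%:R * \sum_i (leak S r i)%:R.
      by rewrite !addr_ge0 // ?mulr_ge0 // ltW.
    by lra.
  apply: (@le_trans _ _ (2 * (ntouched (adv_next blocker t S r))%:R / m%:R)).
    by rewrite ge_min lexx orbT.
  have := ntouched_next t supp nT; rewrite -(ler_nat R) !natrD [T in _ <= _ + T]natr_sum -/n => h1.
  have i2 : 0 <= 2 / m%:R :> R by rewrite divr_ge0 // ltW.
  by have := ler_wpM2l i2 h1; lra.
have -> : \sum_r req_weight R edge S r * f r = (2 * n / m%:R + 2 / m%:R) +
    2 / m%:R * \sum_i \sum_r req_weight R edge S r * (leak S r i)%:R +
    \sum_i \sum_r req_weight R edge S r * (sneak S r i)%:R +
    \sum_r req_weight R edge S r * (quiet S r)%:R.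
  have swap (g : {ffun V -> V} -> 'I_m -> bool) :
      \sum_i \sum_r req_weight R edge S r * (g r i)%:R =
      \sum_r req_weight R edge S r * \sum_i (g r i)%:R.
    by rewrite exchange_big; apply: eq_bigr => r _; rewrite mulr_sumr.
  have const (c : R) : c = \sum_r req_weight R edge S r * c.
    by rewrite -mulr_suml req_weight_sum1 // mul1r.
  rewrite [T in T + _ + _ + _]const.
  rewrite (swap (leak S)) (swap (sneak S)) mulr_sumr -!big_split.
  by apply: eq_bigr => r _ /=; rewrite /f; ring.
have L : \sum_i \sum_r req_weight R edge S r * (leak S r i)%:R <= 1.
  apply: (@le_trans _ _ (\sum_(i < m) m%:R^-1)).
    by apply: ler_sum => i _; exact: leak_pr.
  by rewrite sumr_const card_ord -[leLHS]mulr_natl divff ?gt_eqF.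
have K : \sum_i \sum_r req_weight R edge S r * (sneak S r i)%:R <= m%:R^-1.
  apply: (@le_trans _ _ (\sum_(i < m) (hits (blob i) S)%:R / M%:R)).
    by apply: ler_sum => i _; exact: sneak_pr.
  rewrite -mulr_suml -natr_sum -/(ntouched S) -/n natrM invfM mulrA.
  rewrite -[leRHS]mul1r; apply: ler_wpM2r; first exact: ltW.
  have : 0 <= n / m%:R by rewrite divr_ge0 // ltW.
  by lra.
have Q : \sum_r req_weight R edge S r * (quiet S r)%:R <= 10 / m%:R.
  apply: quiet_pr; rewrite -(ler_nat R) natrM -/n.
  by move: nm1; rewrite ltr_pdivrMr // mul1r => /ltW.
have n0 : 0 <= n by [].
by nra.
Qed.

(** [danger] vanishes for a source outside copy [b] and is 1 when all nodes are informed, so its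
    expectation bounds the probability of being done. *)
Lemma prob_not_done_ge (s : V) t :
  match dec s with NV | NZ _ => true
  | NX b' _ _ | NR b' _ | NY b' _ | NH b' | NW b' _ => b' != b end ->
  1 - t%:R * (15 / m%:R) <= prob_not_done (adv_trans R edge blocker) [set s] t.
Proof.
move=> sb.
have K0 := @adv_trans_ge0 R V edge blocker.
have K1 := @adv_trans_sum1 R V edge blocker gt0.
have E := expect_le_drift K0 K1 [set s] t danger_drift.
have d0 : danger [set s] = 0.
  have nh (B : {set V}) : s \notin B -> hits B [set s] = false.
    by move=> sB; apply/hitsP => -[y yB /set1P ys]; rewrite -ys yB in sB.
  rewrite /danger nh; last by rewrite inE; case: (dec s) sb => // *; apply/negP.
  rewrite /ntouched big1 => [|i _]; last first.
    rewrite nh // inE; case: (dec s) sb => //= [b' i' k|b' i'] /negPf ->; by [].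
  by rewrite mulr0 mul0r min_r.
rewrite d0 add0r in E; apply: (@le_trans _ _ (1%R - \sum_S
    state_dist (adv_trans R edge blocker) [set s] t S * danger S)).
  by rewrite lerD2l lerN2.
rewrite -(state_dist_sum1 K1 [set s] t) -sumrB /prob_not_done.
rewrite [leRHS]big_mkcond; apply: ler_sum => S _.
rewrite -{1}[state_dist _ _ _ _]mulr1 -mulrBr; case: eqVneq => [->|_] /=.
  rewrite (_ : danger setT = 1) ?subrr ?mulr0 // /danger.
  suff -> : hits target setT by [].
  by apply/hitsP; exists H; rewrite !inE ?encK.
rewrite ler_piMr ?state_dist_ge0 //.
by rewrite lerBlDr lerDl danger_ge0.
Qed.

Lemma expected_time_ge (s : V) :
  match dec s with NV | NZ _ => true
  | NX b' _ _ | NR b' _ | NY b' _ | NH b' | NW b' _ => b' != b end ->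
  ((m%:R / 60)%:E <= expected_time (adv_trans R edge blocker) [set s])%E.
Proof.
move=> sb; pose p := prob_not_done (adv_trans R edge blocker) [set s].
have p0 t : 0 <= p t.
  apply: sumr_ge0 => S _; apply: state_dist_ge0; exact: adv_trans_ge0.
(* Up to round [m / 30] the bound [15 * t / m] is at most 1/2, so each of these terms of the series
   is at least 1/2. *)
pose T := (m %/ 30)%N.
apply: (@le_trans _ _ (\sum_(0 <= t < T.+1) (p t)%:E)%E); last first.
  by apply: nneseries_lim_ge => t _ _; rewrite lee_fin.
rewrite sumEFin lee_fin.
apply: (@le_trans _ _ (\sum_(0 <= t < T.+1) 2^-1)).
  rewrite big_const_nat iter_addr addr0 subn0 -[leRHS]mulr_natl.
  have : (m < 30 * T.+1)%N by rewrite /T mulnC; exact: ltn_ceil.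
  by rewrite -(ltr_nat R) natrM; lra.
apply: ler_sum_nat => t /andP[_ tT].
apply: le_trans (prob_not_done_ge t sb).
have : (30 * t <= m)%N.
  by rewrite mulnC; apply: leq_trans (leq_trunc_div m 30); rewrite leq_mul2r -ltnS tT orbT.
rewrite -(ler_nat R) natrM => tm.
rewrite mulrA lerBrDr -lerBrDl ler_pdivrMr //; lra.
Qed.

End Slow.

(** * Numerical estimates *)

Lemma nat_sqrt n : exists m, (m * m <= n < m.+1 * m.+1)%N.
Proof.
elim: n => [|n [m /andP[mn nm]]]; first by exists 0%N.
have [le|lt] := leqP (m.+1 * m.+1) n.+1; last by exists m; rewrite lt andbT leqW.
by exists m.+1; rewrite le /=; nia.
Qed.

Section Numerics.
Variable R : realType.

Lemma ln2_ge : 2^-1 <= ln (2 : R).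
Proof.
rewrite -[leLHS]expRK ler_ln ?posrE ?expR_gt0 //.
rewrite -[2^-1]opprK expRN -[leRHS]invrK lef_pV2 ?posrE ?expR_gt0 //.
by apply: le_trans (expR_ge1Dx _); lra.
Qed.

Lemma ln_nat_ge1 n : (4 <= n)%N -> 1 <= ln (n%:R : R).
Proof.
move=> n4; apply: (@le_trans _ _ (ln ((2 : R) ^+ 2))).
  by rewrite lnXn // mulr2n; have := ln2_ge; lra.
rewrite ler_ln ?posrE ?exprn_gt0 ?ltr0n //; last exact: leq_trans n4.
by rewrite -natrX ler_nat.
Qed.

(** Since [2 ^ (trunc_log 2 n).+2] is at most [4 * n], hence at most [n ^ 3], taking logarithms and
    using that [ln 2] is at least 1/2 gives the factor 6. *)
Lemma trunc_log_le_ln n : (4 <= n)%N -> (trunc_log 2 n).+2%:R <= 6 * ln (n%:R : R).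
Proof.
move=> n4; have l1 := ln_nat_ge1 n4; have l2 := ln2_ge.
have n0 : 0 < n%:R :> R by rewrite ltr0n (leq_trans _ n4).
have : (2 ^ (trunc_log 2 n).+2 <= n ^ 3)%N.
  have := @trunc_logP 2 n isT (leq_trans (isT : 0 < 4)%N n4).
  by rewrite !expnS expn0; nia.
rewrite -(ler_nat R) !natrX -ler_ln ?posrE ?exprn_gt0 // !lnXn //.
by rewrite -[ln 2 *+ _]mulr_natl -[ln _ *+ 3]mulr_natl; nra.
Qed.

Lemma miss_le n tau : (4 <= n)%N -> 1000 * ln (n%:R : R) <= tau%:R ->
  miss R tau <= (n%:R ^+ 5)^-1.
Proof.
move=> n4 tl; have n0 : 0 < n%:R :> R by rewrite ltr0n (leq_trans _ n4).
apply: (@le_trans _ _ (expR (- (1 / 200)) ^+ tau)).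
  by rewrite /miss lerXn2r ?nnegrE ?expR_ge0 ?expR_ge1Dx //; lra.
rewrite -expRM_natl.
have -> : (n%:R ^+ 5)^-1 = expR (- (5 * ln n%:R)) :> R.
  by rewrite expRN expRM_natl lnK.
by rewrite ler_expR; lra.
Qed.

(** [29 * L.+1] is at most 174 times [ln n], so [tau] is at least 1000 times [ln n] and [miss] is at
    most [n ^- 5]. The prefactor is at most [1098 * n ^ 3], where 1098 is 183 * 6, and [n] exceeds
    1098. *)
Lemma failure_le n m t L :
  let tau := (t %/ (29 * L.+1))%N in
  (1200 <= n)%N -> (m * m <= n)%N -> L.+1%:R <= 6 * ln (n%:R : R) ->
  200 * 1000 * ln (n%:R : R) ^+ 2 <= t%:R ->
  (183 * ((m * m) * (m * m * L.+1)))%:R * miss R tau <= n%:R^-1.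
Proof.
move=> tau n1200 mn Ll tl; have n4 : (4 <= n)%N by apply: leq_trans n1200.
have l1 := ln_nat_ge1 n4; set l := ln n%:R in l1 Ll tl *.
have n0 : 0 < n%:R :> R by rewrite ltr0n (leq_trans _ n4).
have n1 : 1200 <= n%:R :> R by rewrite ler_nat.
have ln_le : l <= n%:R by apply/ltW/ln_sublinear.
have J0 : 0 < (29 * L.+1)%:R :> R by rewrite ltr0n.
have tau_ge : 1000 * l <= tau%:R.
  have : (t < (29 * L.+1) * tau.+1)%N by rewrite mulnC; apply: ltn_ceil.
  rewrite -(ltr_nat R) 2!natrM -[tau.+1%:R]natr1 => h.
  have : t%:R <= 174 * l * (tau%:R + 1).
    apply: (le_trans (ltW h)); apply: ler_wpM2r; first by rewrite addr_ge0.
    lra.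
  by nra.
have miss5 := miss_le n4 tau_ge.
have miss0 := miss_ge0 R tau.
apply: (@le_trans _ _ (1098 * n%:R ^+ 3 * (n%:R ^+ 5)^-1)).
  apply: ler_pM => //.
  have mnR : (m * m)%:R <= n%:R :> R by rewrite ler_nat.
  have mm0 : 0 <= (m * m)%:R :> R by [].
  have L0 : 0 <= L.+1%:R :> R by [].
  rewrite 3!natrM.
  have h2 : (m * m)%:R * (m * m)%:R <= n%:R * n%:R :> R by apply: ler_pM.
  have h3 : (m * m)%:R * (m * m)%:R * L.+1%:R <= n%:R * n%:R * (6 * n%:R) :> R.
    by apply: ler_pM => //; lra.
  rewrite mulrA; lra.
have -> : 1098 * n%:R ^+ 3 * (n%:R ^+ 5)^-1 = 1098 / n%:R * n%:R^-1 :> R.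
  by field; rewrite gt_eqF.
rewrite -[leRHS]mul1r; apply: ler_wpM2r; first by rewrite invr_ge0 ltW.
by rewrite ler_pdivrMr // mul1r; lra.
Qed.

End Numerics.

(** * Assembly: the size parameter, the blocked copy and the constants *)

Theorem theorem1 (R : realType) :
  exists (c1 c2 a K c : R),
    [/\ 0 < c1, 0 < c2, 0 < a, 0 < K & 1 <= c] /\
    exists n0 : nat, forall n : nat, (n0 <= n)%N ->
      exists (N : nat) (e : rel 'I_N),
        [/\ symmetric e, irreflexive e, (forall x y, connect e x y),
            c1 * n%:R <= N%:R <= c2 * n%:R &
            forall s : 'I_N,
              (exists A : adversary 'I_N, valid_adversary A /\
                 ((a * Num.sqrt n%:R)%:E
                    <= expected_time (adv_trans R e A) [set s])%E) /\
              (forall t : nat, K * (ln (n%:R : R)) ^+ 2 <= t%:R ->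
                 1 - (n%:R : R) `^ (- c)
                   <= state_dist (rand_trans R e) [set s] t [set: 'I_N])].
Proof.
(* The factor 1/120 comes from the bound [m / 60] and from [Num.sqrt n%:R] being at most [m + 1],
   hence at most [2 * m]; 200 * 1000 and the threshold 1200 come from [failure_le]. *)
exists (1 / 4), 12, (1 / 120), (200 * 1000), 1; split; first by split; lra.
exists 1200%N => n n1200; have [m /andP[mn nm]] := nat_sqrt n.
have m_gt0 : (0 < m)%N by move: nm; case: (m) => //; lia.
pose V := 'I_#|{: node m}|.
pose enc : node m -> V := enum_rank; pose dec : V -> node m := enum_val.
have encK : cancel enc dec by exact: enum_rankK.
have decK : cancel dec enc by exact: enum_valK.
exists #|{: node m}|, (edge dec); split.
- exact: edge_sym.
- exact: edge_irr.
- exact: edge_connect encK decK m_gt0.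
- rewrite card_node; apply/andP; split.
    have : (n <= 4 * (7 * (m * m) + 2 * m + 3))%N by nia.
    by rewrite -(ler_nat R) [(4 * _)%:R]natrM; lra.
  rewrite -natrM ler_nat; nia.
move=> s; split.
  (* The adversary blocks the copy that does not contain the source; for a source in V or Z either
     copy would do. *)
  pose b := match dec s with NV | NZ _ => true
    | NX b' _ _ | NR b' _ | NY b' _ | NH b' | NW b' _ => ~~ b' end.
  exists (blocker enc m_gt0 b); split; first exact: blocker_valid.
  apply: le_trans (expected_time_ge R encK decK m_gt0 (b := b) (s := s) _); last first.
    by rewrite /b; case: (dec s) => // b' *; case: b'.
  rewrite lee_fin.
  have : Num.sqrt n%:R <= m.+1%:R :> R.
    rewrite -[leRHS]gtr0_norm ?ltr0n // -sqrtr_sqr ler_wsqrtr //.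
    by rewrite -natrX ler_nat ltnW.
  have : 1 <= m%:R :> R by rewrite ler1n.
  by rewrite -[m.+1%:R]natr1; lra.
move=> t tK; pose L := (trunc_log 2 n).+1.
have n4 : (4 <= n)%N by apply: leq_trans n1200.
have ML : (m * m <= 2 ^ L)%N.
  by apply: (leq_trans mn); apply: ltnW; apply: trunc_log_ltn.
pose tau := (t %/ (29 * L.+1))%N.
have gt0 := nbrs_gt0 encK decK m_gt0.
have Q0 := rand_trans_ge0 R (edge dec) 0.
have Q1 := rand_trans_sum1 R gt0 0.
have Qm := @rand_trans_mono R V (edge dec) 0.
have setT_up : upclosed (pred1 [set: V]).
  by move=> S S' + /eqP E; rewrite E subTset.
have tau_t : (29 * (L.+1 * tau) <= t)%N.
  by rewrite mulnA mulnC leq_trunc_div.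
(* Being done persists, so the rounds lost by rounding [tau] down do no harm. *)
have [+] := leads_mono Q0 Q1 Qm setT_up tau_t
  (leads_all R encK decK m_gt0 tau ML s).
move=> /(_ [set s]); rewrite /knows set11 => /(_ isT) H.
rewrite powR_inv1 //.
have F := failure_le n1200 mn (trunc_log_le_ln R n4) tK.
(* Passing to the complement of the failure event; the random protocol is time-homogeneous, so its
   state distribution is convertible to that of the constant kernel. *)
have := state_dist_sum1 (K := fun=> rand_trans R (edge dec) 0) (fun=> Q1) [set s] t.
rewrite (bigD1 [set: V]) //= => E.
rewrite -[X in X - _]E.
have {H} : \sum_(S | S != [set: V]) state_dist (fun=> rand_trans R (edge dec) 0) [set s] t S
    <= n%:R^-1.
  apply: le_trans F; apply: le_trans H; rewrite big_mkcond; apply: ler_sum => S _.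
  by case: ifP => _; rewrite ?mulr1 ?mulr0.
by move=> h; rewrite lerBlDr; exact: (lerD (lexx _) h).
Qed.
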